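(* When $n=2$, the computational complexity for globally solving the problem $({\rm CC_B})$, $\min_{z\in\mathbb{R}^2}\max_{x\in\Omega}\|x-z\|^2$ with $\Omega\subseteq\mathbb{R}^2$ the intersection of $p$ given disks, is at most $O(p^2)$.
   Context: Given integers $n,p\ge 1$, centers $a_1,\dots,a_p\in\mathbb{R}^n$ and radii $r_1,\dots,r_p\in(0,+\infty)$, let $\Omega=\{x\in\mathbb{R}^n:\|x-a_i\|^2\le r_i^2,\ i=1,\dots,p\}$, where $\|\cdot\|$ is the Euclidean norm. It is assumed throughout that $\Omega$ has nonempty interior. The Chebyshev center problem is $({\rm CC_B})$: $\min_{z\in\mathbb{R}^n}\max_{x\in\Omega}\|x-z\|^2$, i.e. finding the smallest ball (with center $z$) enclosing $\Omega$. Complexity is counted in elementary operations on the input numbers, performed exactly. *)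

(* Defs.v *)
From mathcomp Require Import all_boot all_order all_algebra.
From mathcomp Require Import all_classical all_reals all_analysis.

Set Implicit Arguments.
Unset Strict Implicit.
Unset Printing Implicit Defensive.

Import Order.TTheory GRing.Theory Num.Theory.
Import numFieldNormedType.Exports.

Local Open Scope classical_set_scope.
Local Open Scope ring_scope.

(* The norm `|x| of the library on row vectors is the sup norm, hence an
   explicit squared Euclidean distance. *)
Definition sqdist (R : realType) (n : nat) (x y : 'rV[R]_n) : R :=
  \sum_(k < n) (x ord0 k - y ord0 k) ^+ 2.

Definition ball_inter (R : realType) (n p : nat)
    (a : 'I_p -> 'rV[R]_n) (r : 'I_p -> R) : set 'rV[R]_n :=
  [set x | forall i, sqdist x (a i) <= r i ^+ 2].

Definition is_max (R : realType) (S : set R) (m : R) : Prop :=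
  S m /\ ubound S m.

Definition is_min (R : realType) (S : set R) (m : R) : Prop :=
  S m /\ lbound S m.

(* m = max_(x in A) |x - z|^2 *)
Definition max_sqdist (R : realType) (n : nat) (A : set 'rV[R]_n)
    (z : 'rV[R]_n) (m : R) : Prop :=
  is_max [set sqdist x z | x in A] m.

(* z is a global minimizer and m the optimal value of
   min_z max_(x in A) |x - z|^2 *)
Definition chebyshev_solution (R : realType) (n : nat) (A : set 'rV[R]_n)
    (z : 'rV[R]_n) (m : R) : Prop :=
  max_sqdist A z m /\ is_min [set m' | exists z', max_sqdist A z' m'] m.

(* Model of computation: a uniform real RAM, given by structured programs.
   The memory holds arrays of natural numbers, used for indexing and control,
   and arrays of exact real numbers; arrays are named by numerals fixed in the
   program.  The operations on reals are + - * / sqrt and comparison; there is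
   no conversion from reals to naturals, and natural numbers can only be added,
   subtracted (truncated at 0) and compared.  The only constants are numerals,
   so that a program cannot depend on the size or the data of the instance. *)
Inductive nexp : Type :=
| NLit of nat
| NGet of nat & nexp
| NAdd of nexp & nexp
| NSub of nexp & nexp.

Inductive rexp : Type :=
| RLit of nat
| RGet of nat & nexp
| RAdd of rexp & rexp
| RSub of rexp & rexp
| RMul of rexp & rexp
| RDiv of rexp & rexp
| RSqrt of rexp.

Inductive test : Type :=
| NLe of nexp & nexp
| RLe of rexp & rexp
| TNot of test.

Inductive prog : Type :=
| Skip
| NSet of nat & nexp & nexp   (* NSet b i e : b[i] := e *)
| RSet of nat & nexp & rexp
| Seq of prog & prog
| If of test & prog & prog
| While of test & prog.

Record state (R : realType) : Type := State {
  nmem : nat -> nat -> nat;   (* array name, then index *)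
  rmem : nat -> nat -> R
}.

Definition upd (T : Type) (m : nat -> nat -> T) (b i : nat) (v : T) :
    nat -> nat -> T :=
  fun c j => if (c == b) && (j == i) then v else m c j.

Fixpoint neval (R : realType) (s : state R) (e : nexp) : nat :=
  match e with
  | NLit k => k
  | NGet b i => nmem s b (neval s i)
  | NAdd e1 e2 => (neval s e1 + neval s e2)%N
  | NSub e1 e2 => (neval s e1 - neval s e2)%N
  end.

Definition lift2 (A B C : Type) (f : A -> B -> option C)
    (x : option A) (y : option B) : option C :=
  obind (fun u => obind (f u) y) x.

(* Division by zero and the square root of a negative number are errors: the
   value is None and the execution is stuck. *)
Fixpoint reval (R : realType) (s : state R) (e : rexp) : option R :=
  match e with
  | RLit k => Some k%:R
  | RGet b i => Some (rmem s b (neval s i))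
  | RAdd e1 e2 => lift2 (fun x y => Some (x + y)) (reval s e1) (reval s e2)
  | RSub e1 e2 => lift2 (fun x y => Some (x - y)) (reval s e1) (reval s e2)
  | RMul e1 e2 => lift2 (fun x y => Some (x * y)) (reval s e1) (reval s e2)
  | RDiv e1 e2 =>
      lift2 (fun x y => if y == 0 then None else Some (x / y))
        (reval s e1) (reval s e2)
  | RSqrt e1 =>
      obind (fun x => if 0 <= x then Some (Num.sqrt x) else None) (reval s e1)
  end.

Fixpoint teval (R : realType) (s : state R) (t : test) : option bool :=
  match t with
  | NLe e1 e2 => Some (neval s e1 <= neval s e2)%N
  | RLe e1 e2 => lift2 (fun x y => Some (x <= y)) (reval s e1) (reval s e2)
  | TNot t1 => omap negb (teval s t1)
  end.

(* Unit cost for every literal, memory access, operation and comparison, on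
   naturals as well as on reals. *)
Fixpoint ncost (e : nexp) : nat :=
  match e with
  | NLit _ => 1
  | NGet _ i => (ncost i).+1
  | NAdd e1 e2 | NSub e1 e2 => (ncost e1 + ncost e2).+1
  end.

Fixpoint rcost (e : rexp) : nat :=
  match e with
  | RLit _ => 1
  | RGet _ i => (ncost i).+1
  | RAdd e1 e2 | RSub e1 e2 | RMul e1 e2 | RDiv e1 e2 =>
      (rcost e1 + rcost e2).+1
  | RSqrt e1 => (rcost e1).+1
  end.

Fixpoint tcost (t : test) : nat :=
  match t with
  | NLe e1 e2 => (ncost e1 + ncost e2).+1
  | RLe e1 e2 => (rcost e1 + rcost e2).+1
  | TNot t1 => (tcost t1).+1
  end.

(* exec c s k s' : started in s, the program c halts in s' after exactly k
   elementary operations. *)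
Inductive exec (R : realType) : prog -> state R -> nat -> state R -> Prop :=
| ExecSkip s : exec Skip s 1 s
| ExecNSet s b i e :
    exec (NSet b i e) s (ncost i + ncost e).+1
      (State (upd (nmem s) b (neval s i) (neval s e)) (rmem s))
| ExecRSet s b i e v :
    reval s e = Some v ->
    exec (RSet b i e) s (ncost i + rcost e).+1
      (State (nmem s) (upd (rmem s) b (neval s i) v))
| ExecSeq c1 c2 s1 s2 s3 k1 k2 :
    exec c1 s1 k1 s2 -> exec c2 s2 k2 s3 ->
    exec (Seq c1 c2) s1 (k1 + k2) s3
| ExecIfTrue t c1 c2 s s' k :
    teval s t = Some true -> exec c1 s k s' ->
    exec (If t c1 c2) s (tcost t + k) s'
| ExecIfFalse t c1 c2 s s' k :
    teval s t = Some false -> exec c2 s k s' ->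
    exec (If t c1 c2) s (tcost t + k) s'
| ExecWhileTrue t c s1 s2 s3 k1 k2 :
    teval s1 t = Some true ->
    exec c s1 k1 s2 -> exec (While t c) s2 k2 s3 ->
    exec (While t c) s1 (tcost t + k1 + k2) s3
| ExecWhileFalse t c s :
    teval s t = Some false ->
    exec (While t c) s (tcost t) s.

Definition tabulate (R : realType) (p : nat) (f : 'I_p -> R) (i : nat) : R :=
  if insub i is Some j then f j else 0.

(* Input: p in cell 0 of the natural array 0; the two coordinates of the
   centers in the real arrays 0 and 1, and the radii in the real array 2.
   All other cells are 0. *)
Definition input (R : realType) (p : nat)
    (a : 'I_p -> 'rV[R]_2) (r : 'I_p -> R) : state R :=
  State
    (fun b i => if (b == 0%N) && (i == 0%N) then p else 0%N)
    (fun b i => match b with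
                | 0 => tabulate (fun j => a j ord0 0) i
                | 1 => tabulate (fun j => a j ord0 1) i
                | 2 => tabulate r i
                | _ => 0
                end).

(* Output: the center in cells 0 and 1 of the real array 3, and the optimal
   value in its cell 2. *)
Definition output_center (R : realType) (s : state R) : 'rV[R]_2 :=
  \row_(k < 2) rmem s 3 k.

Definition output_value (R : realType) (s : state R) : R := rmem s 3 2.

(* Main.v *)
(* Let x be a point of Omega farthest from z.  Moving x along the boundary of
   Omega shows that either x lies on two transversal circles (it is a vertex) or
   x is the point of some circle i opposite to z, and then |x - z| >= r_i.
   Consequently, in a pencil of balls of radius < min r_i that contain all the
   vertices, no ball can stop enclosing Omega: the farthest distance would have
   to jump up to min r_i.  So, if Omega is enclosed by some ball of radius
   < min r_i, the smallest ball enclosing the vertices is the solution;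
   otherwise the smallest disk is.  Which case occurs is decided by testing the
   p opposite points.

   A disk j with r_j <= r_i that does not lie inside disk i contains at most half
   of circle i.  Such arcs meet in a single arc, whose ends are found in O(p)
   operations; filtering these 2p candidates gives the vertices in
   O(p^2).  Their smallest enclosing ball is computed by Chrystal's walk: the
   center of a ball through A and B moves towards the midpoint of [A, B] until
   the ball hits a third vertex, which replaces A or B if the triangle is
   obtuse there.  Vertices beyond the chord AB remain beyond the chord, and each
   stop adds one of them, so that there are O(p) stops of cost O(p). *)

Require Import Defs.
From mathcomp Require Import all_boot all_order all_algebra.
From mathcomp Require Import all_classical all_reals all_analysis.
From mathcomp Require Import zify ring lra.
Set Implicit Arguments.
Unset Strict Implicit.
Unset Printing Implicit Defensive.
Import Order.TTheory GRing.Theory Num.Theory.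
Import numFieldNormedType.Exports.
Local Open Scope classical_set_scope.
Local Open Scope ring_scope.

(** * Farthest points of an intersection of disks *)

Definition sqd (R : realType) (u v : R * R) : R :=
  (u.1 - v.1) ^+ 2 + (u.2 - v.2) ^+ 2.

Definition lens (R : realType) (p : nat) (a : nat -> R * R) (r : nat -> R) :
    set (R * R) :=
  [set x | forall i, (i < p)%N -> sqd x (a i) <= r i ^+ 2].

Definition vertex (R : realType) (p : nat) (a : nat -> R * R) (r : nat -> R)
    (x : R * R) : Prop :=
  lens p a r x /\ exists i j,
    [/\ (i < p)%N, (j < p)%N,
        r j <= r i /\ (r i - r j) ^+ 2 < sqd (a j) (a i),
        sqd x (a i) = r i ^+ 2 & sqd x (a j) = r j ^+ 2].

(* The point of the circle (c, rho) opposite to z; if z = c, its point with the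
   least first coordinate. *)
Definition far_point (R : realType) (z c : R * R) (rho : R) : R * R :=
  if sqd c z <= 0 then (c.1 - rho, c.2)
  else (c.1 + rho / Num.sqrt (sqd c z) * (c.1 - z.1),
        c.2 + rho / Num.sqrt (sqd c z) * (c.2 - z.2)).

Section Plane.
Variable R : realType.
Implicit Types (u v x y z c : R * R) (t s : R).

Lemma sqd_ge0 u v : 0 <= sqd u v.
Proof. by rewrite addr_ge0 ?sqr_ge0. Qed.

Lemma sqd_eq0 u v : sqd u v = 0 -> u = v.
Proof.
move/eqP; rewrite paddr_eq0 ?sqr_ge0// !sqrf_eq0 !subr_eq0 => /andP[/eqP e1 /eqP e2].
by rewrite [u]surjective_pairing e1 e2 -surjective_pairing.
Qed.

Lemma sqd_continuous z : continuous (fun x => sqd x z : R).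
Proof.
have H (w : R) (f : R * R -> R) : continuous f -> continuous (fun x => (f x - w) ^+ 2).
  move=> cf x; rewrite (_ : (fun x => _) = (fun x => (f x - w) * (f x - w))).
    by apply: cvgM; apply: cvgB; [exact: cf|exact: cvg_cst|exact: cf|exact: cvg_cst].
  by apply/funext => y; rewrite expr2.
move=> x; apply: cvgD; apply: H => y; [exact: cvg_fst|exact: cvg_snd].
Qed.

Variables (p : nat) (a : nat -> R * R) (r : nat -> R).

Lemma lens_closed : closed (lens p a r).
Proof.
have -> : lens p a r = \bigcap_(i in [set i | (i < p)%N])
    ((fun x => sqd x (a i)) @^-1` [set t | t <= r i ^+ 2]).
  by apply/seteqP; split => x h i ip; exact: h.
apply: closed_bigI => i _; apply: closed_comp; last exact: closed_le.
by move=> x _; exact: sqd_continuous.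
Qed.

Lemma lens_compact : (0 < p)%N -> compact (lens p a r).
Proof.
(* The half-width [b] needs no square root: [w ^+ 2 <= b - 1] implies [|w| <= b], by the squares of
   [w - 1/2] and [w + 1/2]. *)
move=> p0; set c := a 0%N; set b := r 0%N ^+ 2 + 1.
have H (t w : R) : 0 <= t -> w ^+ 2 + t <= r 0%N ^+ 2 -> - b <= w <= b.
  rewrite /b => t0 h; have h1 := sqr_ge0 (w - 2^-1); have h2 := sqr_ge0 (w + 2^-1).
  by apply/andP; split; nra.
apply: (@subclosed_compact _ _ (`[c.1 - b, c.1 + b] `*` `[c.2 - b, c.2 + b])).
- exact: lens_closed.
- by apply: compact_setX; exact: segment_compact.
- move=> x /(_ 0%N p0) h; rewrite /sqd -/c in h.
  have /andP[h1 h2] := H _ _ (sqr_ge0 (x.2 - c.2)) h.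
  rewrite addrC in h; have /andP[h3 h4] := H _ _ (sqr_ge0 (x.1 - c.1)) h.
  by split; rewrite /= in_itv /=; apply/andP; split; lra.
Qed.

(* Ties are broken by the first coordinate: all points of a circle are at the
   same distance from its center. *)
Lemma lens_farthest z : (0 < p)%N -> lens p a r !=set0 ->
  exists x, [/\ lens p a r x,
    forall y, lens p a r y -> sqd y z <= sqd x z &
    forall y, lens p a r y -> sqd y z = sqd x z -> x.1 <= y.1].
Proof.
move=> p0 O0; have cO := lens_compact p0.
have [|x Ox xmax] := @compact_EVT_max _ _ (fun x => sqd x z) _ O0 cO.
  by apply: continuous_subspaceT; exact: sqd_continuous.
rewrite inE in Ox.
set A := lens p a r `&` ((fun x => sqd x z) @^-1` [set t | t = sqd x z]).
have cA : compact A.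
  apply: compact_closedI => //; apply: closed_comp; last exact: closed_eq.
  by move=> y _; exact: sqd_continuous.
have A0 : A !=set0 by exists x.
have [|y] := @compact_EVT_min _ _ (fun x : R * R => x.1) _ A0 cA.
  by apply: continuous_subspaceT => y; exact: cvg_fst.
rewrite inE => -[Oy yx] ymin; exists y; split=> //.
- by move=> w Ow; rewrite yx; apply: xmax; rewrite inE.
- by move=> w Ow wy; apply: ymin; rewrite inE; split; rewrite //= wy.
Qed.

End Plane.

(** * First and second order conditions at a farthest point *)

Section Perturbation.
Variable R : realType.
Implicit Types (b e s t : R).

(** The triangle inequality on squared distances; Cauchy-Schwarz bounds the cross term by
    [s * (t - s)]. *)
Lemma sqd_nested (u v x : R * R) (s t : R) : 0 <= s -> s <= t ->
  sqd u v <= (t - s) ^+ 2 -> sqd x u <= s ^+ 2 -> sqd x v <= t ^+ 2.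
Proof.
rewrite /sqd => s0 st huv hx.
set p1 := x.1 - u.1 in hx *; set p2 := x.2 - u.2 in hx *.
set q1 := u.1 - v.1 in huv *; set q2 := u.2 - v.2 in huv *.
have -> : x.1 - v.1 = p1 + q1 by rewrite /p1 /q1; ring.
have -> : x.2 - v.2 = p2 + q2 by rewrite /p2 /q2; ring.
suff : p1 * q1 + p2 * q2 <= s * (t - s) by nra.
have ts0 : 0 <= t - s by lra.
have st0 : 0 <= s * (t - s) by rewrite mulr_ge0.
case: (lerP (p1 * q1 + p2 * q2) 0) => [|h]; first by move/le_trans; apply.
rewrite -(@ler_pXn2r _ 2) ?nnegrE ?(ltW h)//.
apply: (@le_trans _ _ ((p1 ^+ 2 + p2 ^+ 2) * (q1 ^+ 2 + q2 ^+ 2))).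
  by have := sqr_ge0 (p1 * q2 - p2 * q1); nra.
by rewrite exprMn; apply: ler_pM; rewrite ?addr_ge0 ?sqr_ge0.
Qed.

(** Necessary conditions for a local maximum at [t = 0]. A nonzero [b] would dominate [t * c] for
    small [t], and [t] with the sign of [b] would make the product positive. *)
Lemma quadratic_sign b (c : R) e : 0 < e ->
  (forall t, `|t| < e -> t * (b - t * c) <= 0) -> b = 0 /\ 0 <= c.
Proof.
move=> e0 H.
have {}H t : - e < t < e -> t * (b - t * c) <= 0 by rewrite -ltr_norml; exact: H.
have b0 : b = 0.
  apply/eqP; rewrite -[_ == _]negbK; apply/negP => b0.
  have K : 0 < `|c| + 1 by rewrite ltr_wpDl.
  have nb : 0 < `|b| by rewrite normr_gt0.
  (* This [d] is admissible and satisfies [d * c < |b|], so [b - t * c] keeps the sign of [b] at the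
     [t = d] or [t = - d] used below. *)
  pose d := Num.min (e / 2) (`|b| / (2 * (`|c| + 1))).
  have d0 : 0 < d by rewrite lt_min !divr_gt0// mulr_gt0.
  have de : d < e by rewrite gt_min; apply/orP; left; lra.
  have dc : d * c < `|b|.
    apply: (@le_lt_trans _ _ (d * (`|c| + 1))).
      by rewrite ler_pM2l// (le_trans (ler_norm c))// lerDl.
    rewrite -ltr_pdivlMr// gt_min; apply/orP; right.
    by rewrite invfM mulrA ltr_pM2r ?invr_gt0//; lra.
  case: (ltrP 0 b) => [bp|bn].
    rewrite gtr0_norm// in dc.
    have /H : - e < d < e by apply/andP; split; lra.
    by apply/negP; rewrite -ltNge mulr_gt0//; lra.
  rewrite ler0_norm// in dc.
  have /H : - e < - d < e by apply/andP; split; lra.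
  by apply/negP; rewrite -ltNge mulNr -mulrN mulr_gt0//; lra.
split => //; move: H; rewrite b0 => H.
have /H : - e < e / 2 < e by apply/andP; split; lra.
by rewrite sub0r mulrN oppr_le0 !pmulr_rge0 ?divr_gt0.
Qed.

(** Rotation of [x] about [c], with [t] the tangent of half the angle. This rational form makes the
    change in squared distance quadratic in [t] up to a positive factor. *)
Definition rot (x c : R * R) t : R * R :=
  (c.1 + ((1 - t ^+ 2) * (x.1 - c.1) - 2 * t * (x.2 - c.2)) / (1 + t ^+ 2),
   c.2 + ((1 - t ^+ 2) * (x.2 - c.2) + 2 * t * (x.1 - c.1)) / (1 + t ^+ 2)).

Lemma sqd_rot (x c : R * R) t : sqd (rot x c t) c = sqd x c.
Proof.
rewrite /sqd /rot /=; have ? : 1 + t ^+ 2 != 0 by have := sqr_ge0 t; lra.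
by field.
Qed.

Lemma lt_sqd_near (x c : R * R) s : sqd x c < s -> exists2 e, 0 < e &
  forall y, `|y.1 - x.1| < e -> `|y.2 - x.2| < e -> sqd y c <= s.
Proof.
move=> h; have : nbhs x [set y | sqd y c < s].
  apply: open_nbhs_nbhs; split => //.
  apply: (@open_comp _ _ (fun y => sqd y c) [set t | t < s]); last exact: open_lt.
  by move=> y _; exact: sqd_continuous.
move=> /nbhs_ballP[e /= e0 he]; exists e => // y y1 y2.
by apply/ltW/he; split; rewrite /ball /= distrC.
Qed.

(** Constraints that are strict at [x] persist nearby by continuity, so only the active ones have to
    be supplied by [P]. *)
Lemma lens_near p (a : nat -> R * R) (r : nat -> R) x (P : R * R -> Prop) :
  lens p a r x ->
  (forall j y, (j < p)%N -> sqd x (a j) = r j ^+ 2 -> P y -> sqd y (a j) <= r j ^+ 2) ->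
  exists2 e, 0 < e &
    forall y, P y -> `|y.1 - x.1| < e -> `|y.2 - x.2| < e -> lens p a r y.
Proof.
move=> Ox HP.
have H (j : 'I_p) : exists e, 0 < e /\
    forall y, P y -> `|y.1 - x.1| < e -> `|y.2 - x.2| < e -> sqd y (a j) <= r j ^+ 2.
  have := Ox j (ltn_ord j); rewrite le_eqVlt => /orP[/eqP h|/lt_sqd_near[e e0 he]].
    by exists 1; split => // y Py _ _; exact: HP.
  by exists e; split => // y _; exact: he.
have [e He] := choice H.
exists (\big[Num.min/1]_j e j).
  by apply/bigmin_gtP; split => // j _; have [] := He j.
move=> y Py y1 y2 j jp; have [_] := He (Ordinal jp); apply => //=.
  by apply: (lt_le_trans y1); exact: bigmin_le.
by apply: (lt_le_trans y2); exact: bigmin_le.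
Qed.

Lemma rot_near (x c : R * R) e : 0 < e -> exists2 d, 0 < d &
  forall t, `|t| < d -> `|(rot x c t).1 - x.1| < e /\ `|(rot x c t).2 - x.2| < e.
Proof.
move=> e0; set K := `|x.1 - c.1| + `|x.2 - c.2| + 1.
have K0 : 0 < K by rewrite ltr_wpDl// addr_ge0.
exists (Num.min 1 (e / (2 * K))); first by rewrite lt_min ltr01 divr_gt0// mulr_gt0.
have H (w u v t : R) : `|t| < Num.min 1 (e / (2 * K)) -> `|u| + `|v| + 1 <= K ->
    `|w + ((1 - t ^+ 2) * u - 2 * t * v) / (1 + t ^+ 2) - (w + u)| < e.
  rewrite lt_min => /andP[t1 tK] uv.
  have T : 0 < 1 + t ^+ 2 by have := sqr_ge0 t; lra.
  have -> : w + ((1 - t ^+ 2) * u - 2 * t * v) / (1 + t ^+ 2) - (w + u) =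
    - (2 * t) * (t * u + v) / (1 + t ^+ 2) by field; rewrite gt_eqF.
  rewrite normrM normfV (gtr0_norm T) ltr_pdivrMr//.
  apply: (@lt_le_trans _ _ e); last by rewrite ler_peMr ?(ltW e0)// lerDl sqr_ge0.
  rewrite normrM normrN normrM ger0_norm//.
  apply: (@le_lt_trans _ _ (2 * `|t| * K)).
    apply: ler_wpM2l; first by rewrite mulr_ge0.
    apply: (le_trans (ler_normD _ _)); rewrite normrM.
    by have := normr_ge0 u; have := normr_ge0 v; have := normr_ge0 t; nra.
  by move: tK; rewrite ltr_pdivlMr ?mulr_gt0// => h; lra.
move=> t td; split; rewrite /rot /=.
  by have := H c.1 (x.1 - c.1) (x.2 - c.2) t td (lexx _); rewrite subrKC.
(* The second coordinate is an instance of the first one after a quarter turn. *)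
have := H c.2 (x.2 - c.2) (- (x.1 - c.1)) t td.
by rewrite normrN mulrN opprK subrKC; apply; rewrite /K [X in X + 1]addrC.
Qed.

(** Take an active circle [i] of least radius. If [x] is not a vertex, every active disk contains
    disk [i], so a whole arc of circle [i] around [x] lies in the lens. Maximality along this arc
    puts [a i] on the segment from [z] to [x], whence the distance is at least [r i]. *)
Theorem farthest_point p (a : nat -> R * R) (r : nat -> R) z :
  (0 < p)%N -> (forall i, (i < p)%N -> 0 < r i) -> lens p a r !=set0 ->
  exists x, [/\ lens p a r x, forall y, lens p a r y -> sqd y z <= sqd x z &
    vertex p a r x \/ exists i, [/\ (i < p)%N, r i ^+ 2 <= sqd x z &
      x = far_point z (a i) (r i)]].
Proof.
move=> p0 r0 O0; have [x [Ox xmax xlex]] := lens_farthest z p0 O0.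
exists x; split => //; have [|nvx] := pselect (vertex p a r x); [by left|right].
pose act := [pred i : 'I_p | sqd x (a i) == r i ^+ 2].
case: (pickP act) => [i0 ai0|noact]; last first.
  have [e e0 He] : exists2 e, 0 < e &
      forall y, True -> `|y.1 - x.1| < e -> `|y.2 - x.2| < e -> lens p a r y.
    apply: lens_near => // j y jp xj _.
    by have := noact (Ordinal jp); rewrite /= xj eqxx.
  (* With no active constraint, a small horizontal move away from [z] would increase the
     distance. *)
  have H t : `|t| < e -> sqd (x.1 + t, x.2) z <= sqd x z.
    move=> te; apply/xmax/He => //=; first by rewrite addrAC subrr add0r.
    by rewrite subrr normr0.
  exfalso; case: (lerP 0 (x.1 - z.1)) => h.
    by have := H (e / 2); rewrite ger0_norm /sqd /=; [|lra]; move/(_ ltac:(lra)); nra.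
  have := H (- (e / 2)); rewrite normrN ger0_norm /sqd /=; last lra.
  by move/(_ ltac:(lra)); nra.
have [i /= /eqP xi imin] : exists2 i, act i & forall j, act j -> r i <= r j.
  by case: (@arg_minP _ _ _ i0 act (fun i => r i) ai0) => i; exists i.
have ri0 := r0 i (ltn_ord i).
have [e e0 He] : exists2 e, 0 < e & forall y, sqd y (a i) = r i ^+ 2 ->
    `|y.1 - x.1| < e -> `|y.2 - x.2| < e -> lens p a r y.
  apply: lens_near => // j y jp xj yi.
  have ij : r i <= r j by apply: (imin (Ordinal jp)); rewrite /= xj.
  apply: (@sqd_nested (a i) _ y (r i)) => //; [exact: ltW| |by rewrite yi].
  (* An active disk [j] that does not contain disk [i] would make [x] a vertex on the circles [j]
     and [i]. *)
  rewrite leNgt; apply/negP => h; apply: nvx; split => //.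
  by exists j, i; split.
have [d d0 Hd] := rot_near x (a i) e0.
have Orot t : `|t| < d -> lens p a r (rot x (a i) t).
  by move=> /Hd[h1 h2]; apply: He => //; rewrite sqd_rot.
set n1 := x.1 - (a i).1; set n2 := x.2 - (a i).2.
set e1 := (a i).1 - z.1; set e2 := (a i).2 - z.2.
have nE : n1 ^+ 2 + n2 ^+ 2 = r i ^+ 2 := xi.
have T t : 0 < 1 + t ^+ 2 by have := sqr_ge0 t; lra.
have T0 t : 1 + t ^+ 2 != 0 by rewrite gt_eqF.
have rotE t : sqd (rot x (a i) t) z - sqd x z =
    4 / (1 + t ^+ 2) * (t * ((e2 * n1 - e1 * n2) - t * (e1 * n1 + e2 * n2))).
  by rewrite /sqd /rot /= /n1 /n2 /e1 /e2; field; exact: T0.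
(* The first order condition makes [x - a i] parallel to [a i - z], and the second order one makes
   them point the same way. *)
have [|cross0 dot0] := @quadratic_sign (e2 * n1 - e1 * n2) (e1 * n1 + e2 * n2) d d0.
  by move=> t /Orot/xmax; rewrite -subr_le0 rotE pmulr_rle0 ?divr_gt0.
exists i; split => //.
  rewrite -nE /sqd; have -> : x.1 - z.1 = n1 + e1 by rewrite /n1 /e1; ring.
  have -> : x.2 - z.2 = n2 + e2 by rewrite /n2 /e2; ring.
  by have := sqr_ge0 e1; have := sqr_ge0 e2; nra.
rewrite [x]surjective_pairing /far_point; set D := sqd (a i) z.
have DE : D = e1 ^+ 2 + e2 ^+ 2 by [].
case: ifPn => [D0|].
  have {}D0 : D = 0 by apply/eqP; rewrite eq_le D0 sqd_ge0.
  have := sqd_eq0 D0 => az.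
  (* When [z] is the center all rotated points tie, and the least first coordinate becomes the
     extremal condition that determines [x]. *)
  have rmax t : sqd (rot x (a i) t) z = sqd x z.
    by apply/eqP; rewrite -subr_eq0 rotE /e1 /e2 az !subrr; apply/eqP; ring.
  have [|n20 n10] := @quadratic_sign n2 (- n1) d d0.
    move=> t td; have := xlex _ (Orot t td) (rmax t).
    rewrite -subr_ge0 -oppr_le0.
    have -> : - ((rot x (a i) t).1 - x.1) = 2 / (1 + t ^+ 2) * (t * (n2 - t * (- n1))).
      by rewrite /rot /= /n1 /n2; field; exact: T0.
    by rewrite pmulr_rle0 ?divr_gt0.
  have n1E : n1 = - r i.
    move: nE; rewrite n20 expr0n addr0 => /eqP; rewrite eqf_sqr => /orP[/eqP h|/eqP//].
    lra.
  by congr pair; [rewrite -n1E /n1|move: n20; rewrite /n2]; lra.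
rewrite -ltNge => D0; set q := Num.sqrt D.
have q0 : 0 < q by rewrite sqrtr_gt0.
have qE : q ^+ 2 = D by rewrite sqr_sqrtr// ltW.
(* By Lagrange's identity, a zero cross product turns Cauchy-Schwarz into an equality. *)
have kE : e1 * n1 + e2 * n2 = r i * q.
  apply/eqP; rewrite -(@eqrXn2 _ 2) ?(mulr_ge0 (ltW ri0) (ltW q0))//.
  rewrite exprMn qE -nE DE; apply/eqP.
  have -> : (e1 * n1 + e2 * n2) ^+ 2 =
    (n1 ^+ 2 + n2 ^+ 2) * (e1 ^+ 2 + e2 ^+ 2) - (e2 * n1 - e1 * n2) ^+ 2 by ring.
  by rewrite cross0 expr0n subr0.
have n1E : n1 = r i / q * e1.
  apply: (@mulfI _ D); first by rewrite gt_eqF.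
  have -> : D * (r i / q * e1) = (r i * q) * e1 by rewrite -qE; field; rewrite gt_eqF.
  rewrite -kE DE; have -> : (e1 ^+ 2 + e2 ^+ 2) * n1 =
    (e1 * n1 + e2 * n2) * e1 + (e2 * n1 - e1 * n2) * e2 by ring.
  by rewrite cross0 mul0r addr0.
have n2E : n2 = r i / q * e2.
  apply: (@mulfI _ D); first by rewrite gt_eqF.
  have -> : D * (r i / q * e2) = (r i * q) * e2 by rewrite -qE; field; rewrite gt_eqF.
  rewrite -kE DE; have -> : (e1 ^+ 2 + e2 ^+ 2) * n2 =
    (e1 * n1 + e2 * n2) * e2 - (e2 * n1 - e1 * n2) * e1 by ring.
  by rewrite cross0 mul0r subr0.
by rewrite -n1E -n2E /n1 /n2 !subrKC -surjective_pairing.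
Qed.

End Perturbation.

(** * Pencils of balls containing the vertices *)

Section Enclosing.
Variable R : realType.
Implicit Types (s t : R).

(** The ball [(z', s')] is deformed into [(z, s)] through the pencil they span. At each stage the
    farthest point is a vertex, which is enclosed, or is at squared distance at least [rho]. The
    excess [g] over the lens therefore cannot have its maximum strictly between 0 and [d], and small
    steps cannot cross that gap. *)
Lemma vertices_enclose_lens p (a : nat -> R * R) (r : nat -> R) z s z' s' rho :
  (0 < p)%N -> (forall i, (i < p)%N -> 0 < r i) -> lens p a r !=set0 ->
  (forall i, (i < p)%N -> rho <= r i ^+ 2) -> s < rho -> s' < rho ->
  (forall v, vertex p a r v -> sqd v z <= s) ->
  (forall x, lens p a r x -> sqd x z' <= s') ->
  forall x, lens p a r x -> sqd x z <= s.
Proof.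
move=> p0 r0 O0 rho_le s_lt s'_lt Vz Oz'.
pose g0 x := sqd x z - s; pose g1 x := sqd x z' - s'.
pose g t x := (1 - t) * g0 x + t * g1 x.
pose zt t := ((1 - t) * z.1 + t * z'.1, (1 - t) * z.2 + t * z'.2).
(* [zt t] and [st t] are the center and squared radius of the pencil's member [t]; the last term of
   [st] comes from completing the square. *)
pose st t := (1 - t) * s + t * s' - t * (1 - t) * sqd z z'.
have gE t x : g t x = sqd x (zt t) - st t.
  by rewrite /g /g0 /g1 /st /sqd /zt /=; ring.
pose sm := Num.max s s'; pose d := rho - sm.
have d0 : 0 < d by rewrite subr_gt0 gt_max s_lt.
have st_le t : 0 <= t <= 1 -> st t <= sm.
  move=> /andP[t0 t1]; have zz := sqd_ge0 z z'.
  have h1 : s <= sm by rewrite le_max lexx.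
  have h2 : s' <= sm by rewrite le_max lexx orbT.
  have t1' : 0 <= 1 - t by rewrite subr_ge0.
  have h3 : 0 <= t * (1 - t) * sqd z z' by rewrite !mulr_ge0.
  by rewrite /st; nra.
have gap t : 0 <= t <= 1 ->
    (forall x, lens p a r x -> g t x < d) -> forall x, lens p a r x -> g t x <= 0.
  move=> t01 gd; have [x [Ox xmax [Vx|[i [ip hi _]]]]] := farthest_point (zt t) p0 r0 O0.
    move=> y Oy; apply: (@le_trans _ _ (g t x)); first by rewrite !gE lerD2r; exact: xmax.
    have [t0 t1] := andP t01; have gz := Vz x Vx; have gz' := Oz' x Ox.
    by rewrite /g /g0 /g1; nra.
  exfalso; have := gd x Ox; rewrite gE ltNge => /negP; apply.
  by rewrite /d lerB ?st_le// (le_trans (rho_le i ip)).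
have [xm [_ xmmax _]] := farthest_point z p0 r0 O0.
pose K := `|sqd xm z - s + s'| + 1.
have K0 : 0 < K by rewrite ltr_wpDl.
have gK x : lens p a r x -> g0 x - g1 x <= K.
  move=> Ox; rewrite /g0 /g1 /K; have := xmmax _ Ox; have := sqd_ge0 x z'.
  by have := ler_norm (sqd xm z - s + s'); lra.
(* Going from [t = 1] to [t = 0] in [N] equal steps, each step raises [g] by at most [K / N < d]. *)
pose N := (Num.truncn (K / d)).+1.
have Nd : K / N%:R < d.
  by rewrite ltr_pdivrMr ?ltr0n// mulrC -ltr_pdivrMr// truncnS_gt.
have step n : (n <= N)%N -> forall x, lens p a r x -> g (1 - n%:R / N%:R) x <= 0.
  elim: n => [_ x Ox|n IH nN].
    by rewrite mul0r subr0 /g subrr mul0r add0r mul1r subr_le0 Oz'.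
  apply: gap.
    rewrite subr_ge0 ler_pdivrMr ?ltr0n// mul1r ler_nat nN/=.
    by rewrite lerBlDr lerDl divr_ge0.
  move=> x Ox; apply: le_lt_trans Nd.
  have := IH (ltnW nN) x Ox; have := gK x Ox.
  rewrite -(@ler_pM2l _ (N%:R^-1)) ?invr_gt0 ?ltr0n// -natr1 mulrDl /g.
  by move: (g0 x) (g1 x) (n%:R / N%:R) => u v w; lra.
move=> x Ox; have := step N (leqnn N) x Ox.
by rewrite divff ?pnatr_eq0// subrr /g subr0 mul1r mul0r addr0 subr_le0.
Qed.

End Enclosing.

(** * Vertices as ends of arcs *)

Section Arcs.
Variable R : realType.
Implicit Types (c u v w : R * R) (rho s sg : R).

(* Scaled so that a point c + v of the circle (c, rho) is in the disk (c', rho')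
   iff chord_num <= 2 v.(c' - c). *)
Definition chord_num c rho c' rho' : R := rho ^+ 2 + sqd c' c - rho' ^+ 2.

(** By Heron's formula, 16 times the squared area of the triangle formed by the two centers and a
    common point of the circles. *)
Definition chord_disc c rho c' rho' : R :=
  4 * rho ^+ 2 * sqd c' c - chord_num c rho c' rho' ^+ 2.

Definition clips c rho c' rho' : bool :=
  [&& rho' <= rho, (rho - rho') ^+ 2 < sqd c' c & 0 <= chord_disc c rho c' rho'].

(* End of the arc of the circle (c, rho) in the disk (c', rho'), relative to c;
   sg = 1 for the counterclockwise end and -1 for the other one. *)
Definition arc_end sg c rho c' rho' : R * R :=
  let k := chord_num c rho c' rho' in
  let h := sg * Num.sqrt (chord_disc c rho c' rho') in
  ((k * (c'.1 - c.1) - h * (c'.2 - c.2)) / (2 * sqd c' c),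
   (k * (c'.2 - c.2) + h * (c'.1 - c.1)) / (2 * sqd c' c)).

Definition arc_step sg c rho u c' rho' : R * R :=
  let e := arc_end sg c rho c' rho' in
  if clips c rho c' rho' && (sg * (u.1 * e.2 - u.2 * e.1) <= 0) then e else u.

(* The start value 0 is replaced at the first clipping disk, since its cross
   product with any vector vanishes. *)
Definition arc_corner sg (a : nat -> R * R) (r : nat -> R) i n : R * R :=
  iteri n (fun j u => arc_step sg (a i) (r i) u (a j) (r j)) (0, 0).

Section OneCircle.
Variables (sg : R) (c : R * R) (rho : R).
Hypotheses (sg1 : sg = 1 \/ sg = -1) (rho0 : 0 < rho).

Let sg2 : sg * sg = 1. Proof. by case: sg1 => ->; lra. Qed.

(** A disk that is not larger cuts the circle in less than a half turn. This is what allows cross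
    products to order the arc ends. *)
Lemma chord_num_gt0 c' rho' : 0 < rho' -> rho' <= rho -> 0 < sqd c' c ->
  0 < chord_num c rho c' rho'.
Proof.
move=> rho'0 le_rho W0.
have : rho' ^+ 2 <= rho ^+ 2 by rewrite ler_sqr ?nnegrE ?(ltW rho0) ?(ltW rho'0).
by rewrite /chord_num; lra.
Qed.

Lemma arc_endE c' rho' (e := arc_end sg c rho c' rho') : clips c rho c' rho' ->
  0 < rho' ->
  [/\ 0 < chord_num c rho c' rho', 0 < sqd c' c, e.1 ^+ 2 + e.2 ^+ 2 = rho ^+ 2,
    2 * (e.1 * (c'.1 - c.1) + e.2 * (c'.2 - c.2)) = chord_num c rho c' rho' &
    2 * ((c'.1 - c.1) * e.2 - (c'.2 - c.2) * e.1) =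
      sg * Num.sqrt (chord_disc c rho c' rho')].
Proof.
rewrite /e => /and3P[le_rho rho_lt disc0] rho'0.
have W0 : 0 < sqd c' c by apply: le_lt_trans rho_lt; exact: sqr_ge0.
have K0 := chord_num_gt0 rho'0 le_rho W0.
have := sqr_sqrtr disc0; rewrite {2}/chord_disc /arc_end.
set h := Num.sqrt _; set k := chord_num _ _ _ _ => hE.
have W0' : sqd c' c != 0 by rewrite gt_eqF.
move: hE W0'; rewrite [sqd c' c]/sqd => hE W0'; split => //=.
- apply: (@mulIf _ (4 * ((c'.1 - c.1) ^+ 2 + (c'.2 - c.2) ^+ 2))).
    by rewrite mulf_neq0// pnatr_eq0.
  transitivity (k ^+ 2 + sg * sg * h ^+ 2); first by field.
  by rewrite sg2 hE; ring.
- by field.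
- by field.
Qed.

Variable v : R * R.
Hypothesis v_rho : v.1 ^+ 2 + v.2 ^+ 2 = rho ^+ 2.

Lemma chord_of_mem c' rho' :
  sqd (c.1 + v.1, c.2 + v.2) c' <= rho' ^+ 2 ->
  chord_num c rho c' rho' <= 2 * (v.1 * (c'.1 - c.1) + v.2 * (c'.2 - c.2)).
Proof. by rewrite /chord_num -v_rho /sqd /= => h; nra. Qed.

Lemma chord_of_mem_eq c' rho' :
  sqd (c.1 + v.1, c.2 + v.2) c' = rho' ^+ 2 ->
  chord_num c rho c' rho' = 2 * (v.1 * (c'.1 - c.1) + v.2 * (c'.2 - c.2)).
Proof. by rewrite /chord_num -v_rho /sqd /= => <-; ring. Qed.

(** A point of the circle inside the disk bounds [chord_num] by Cauchy-Schwarz, which makes the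
    discriminant nonnegative. *)
Lemma mem_clips c' rho' : 0 < rho' ->
  rho' <= rho -> (rho - rho') ^+ 2 < sqd c' c ->
  sqd (c.1 + v.1, c.2 + v.2) c' <= rho' ^+ 2 -> clips c rho c' rho'.
Proof.
move=> rho'0 le_rho rho_lt /chord_of_mem kv; rewrite /clips le_rho rho_lt /=.
have W0 : 0 < sqd c' c by apply: le_lt_trans rho_lt; exact: sqr_ge0.
have K0 := chord_num_gt0 rho'0 le_rho W0.
rewrite subr_ge0 -v_rho.
apply: (@le_trans _ _ ((2 * (v.1 * (c'.1 - c.1) + v.2 * (c'.2 - c.2))) ^+ 2)).
  by rewrite ler_sqr ?nnegrE// ltW// (lt_le_trans K0).
by rewrite /sqd; have := sqr_ge0 (v.1 * (c'.2 - c.2) - v.2 * (c'.1 - c.1)); nra.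
Qed.

(** A point [v] of an arc shorter than a half turn precedes its end [e] in the direction [sg]. A
    zero cross product leaves [e = v] or [e = - v], and the latter lies on the wrong side of the
    chord. *)
Lemma arc_end_after c' rho' (e := arc_end sg c rho c' rho') :
  clips c rho c' rho' -> 0 < rho' ->
  sqd (c.1 + v.1, c.2 + v.2) c' <= rho' ^+ 2 ->
  0 <= sg * (v.1 * e.2 - v.2 * e.1) /\ (sg * (v.1 * e.2 - v.2 * e.1) <= 0 -> e = v).
Proof.
move=> clip rho'0 /chord_of_mem kv; have [k0 W0] := arc_endE clip rho'0.
have disc0 : 0 <= chord_disc c rho c' rho' by case/and3P: clip.
have := sqr_sqrtr disc0; rewrite {2}/chord_disc -/e; clearbody e.
move: W0 kv k0; rewrite [sqd c' c]/sqd; have := sqrtr_ge0 (chord_disc c rho c' rho').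
set h := Num.sqrt _; set k := chord_num _ _ _ _ => h0 W0 kv k0 hE eN eK eH.
set w1 := c'.1 - c.1 in W0 kv hE eK eH; set w2 := c'.2 - c.2 in W0 kv hE eK eH.
have cr : 0 <= sg * (v.1 * e.2 - v.2 * e.1).
  rewrite -(@pmulr_rge0 _ (4 * (w1 ^+ 2 + w2 ^+ 2))) ?mulr_gt0//.
  have -> : 4 * (w1 ^+ 2 + w2 ^+ 2) * (sg * (v.1 * e.2 - v.2 * e.1)) =
     (2 * (v.1 * w1 + v.2 * w2)) * (sg * (2 * (w1 * e.2 - w2 * e.1))) -
     sg * (2 * (w1 * v.2 - w2 * v.1)) * (2 * (e.1 * w1 + e.2 * w2)) by ring.
  rewrite eK eH (mulrA sg sg) sg2 mul1r.
  (* Along and across [c' - c], [v] has scaled coordinates [(x, y)] and the arc end [(k, h)]. They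
     have equal norms, so [x >= k > 0] forces [y <= h], and [x * h - y * k >= 0]. *)
  set x := 2 * (v.1 * w1 + v.2 * w2) in kv *; set y := sg * (2 * (w1 * v.2 - w2 * v.1)).
  have xy : x ^+ 2 + y ^+ 2 = k ^+ 2 + h ^+ 2.
    have -> : y ^+ 2 = 4 * (sg * sg) * (w1 * v.2 - w2 * v.1) ^+ 2 by rewrite /y; ring.
    by rewrite hE -v_rho sg2 /x; ring.
  have [y0|y0] := lerP y 0; first by nra.
  have yh : y <= h by rewrite -ler_sqr ?nnegrE ?(ltW y0)//; nra.
  by nra.
split=> // cr'; have {cr' cr} : sg * (v.1 * e.2 - v.2 * e.1) = 0.
  by apply/eqP; rewrite eq_le cr cr'.
move=> /(congr1 (fun t => sg * t)); rewrite mulrA sg2 mul1r mulr0 => cr0.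
have /eqP : (v.1 * e.1 + v.2 * e.2) ^+ 2 = (rho ^+ 2) ^+ 2.
  have -> : (v.1 * e.1 + v.2 * e.2) ^+ 2 = (v.1 ^+ 2 + v.2 ^+ 2) *
    (e.1 ^+ 2 + e.2 ^+ 2) - (v.1 * e.2 - v.2 * e.1) ^+ 2 by ring.
  by rewrite v_rho eN cr0; ring.
rewrite eqf_sqr => /orP[] /eqP h1.
  apply: sqd_eq0; have -> : sqd e v = (v.1 ^+ 2 + v.2 ^+ 2) +
    (e.1 ^+ 2 + e.2 ^+ 2) - 2 * (v.1 * e.1 + v.2 * e.2) by rewrite /sqd; ring.
  by rewrite v_rho eN h1; ring.
have : sqd v (- e.1, - e.2) = 0.
  have -> : sqd v (- e.1, - e.2) = (v.1 ^+ 2 + v.2 ^+ 2) +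
    (e.1 ^+ 2 + e.2 ^+ 2) + 2 * (v.1 * e.1 + v.2 * e.2) by rewrite /sqd /=; ring.
  by rewrite v_rho eN h1; ring.
move/sqd_eq0 => h2; have {h2}[v1 v2] : v.1 = - e.1 /\ v.2 = - e.2 by rewrite h2.
by exfalso; move: kv; rewrite v1 v2 !mulNr -opprD mulrN eK; lra.
Qed.

(** The circles meet in two points mirrored in the line of centers; the sign of the cross product
    tells which one is [v]. *)
Lemma arc_end_mem c' rho' : clips c rho c' rho' -> 0 < rho' ->
  sqd (c.1 + v.1, c.2 + v.2) c' = rho' ^+ 2 ->
  0 <= sg * ((c'.1 - c.1) * v.2 - (c'.2 - c.2) * v.1) ->
  arc_end sg c rho c' rho' = v.
Proof.
move=> clip rho'0 /chord_of_mem_eq kv; have [k0 W0] := arc_endE clip rho'0.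
have disc0 : 0 <= chord_disc c rho c' rho' by case/and3P: clip.
have := sqr_sqrtr disc0; rewrite {2}/chord_disc.
move: W0 kv k0; rewrite [sqd c' c]/sqd; have := sqrtr_ge0 (chord_disc c rho c' rho').
set e := arc_end _ _ _ _ _.
set h := Num.sqrt _; set k := chord_num _ _ _ _ => h0 W0 kv k0 hE eN eK eH.
set w1 := c'.1 - c.1 in W0 kv hE eK eH *; set w2 := c'.2 - c.2 in W0 kv hE eK eH *.
move=> s0; have vh : 2 * (sg * (w1 * v.2 - w2 * v.1)) = h.
  apply/eqP; rewrite -(@eqrXn2 _ 2)//; last by rewrite mulr_ge0.
  rewrite hE kv -v_rho.
  have -> : (2 * (sg * (w1 * v.2 - w2 * v.1))) ^+ 2 =
     4 * (sg * sg) * (w1 * v.2 - w2 * v.1) ^+ 2 by ring.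
  by rewrite sg2; apply/eqP; ring.
have d1 : (e.1 - v.1) * w1 + (e.2 - v.2) * w2 = 0 by lra.
have d2 : w1 * (e.2 - v.2) - w2 * (e.1 - v.1) = 0.
  suff : 2 * (w1 * e.2 - w2 * e.1) = 2 * (w1 * v.2 - w2 * v.1) by lra.
  rewrite eH -vh; transitivity (sg * sg * (2 * (w1 * v.2 - w2 * v.1))); first by ring.
  by rewrite sg2 mul1r.
apply: sqd_eq0; apply: (@mulIf _ (w1 ^+ 2 + w2 ^+ 2)); first by rewrite gt_eqF.
rewrite mul0r; have -> : sqd e v * (w1 ^+ 2 + w2 ^+ 2) =
  ((e.1 - v.1) * w1 + (e.2 - v.2) * w2) ^+ 2 +
  (w1 * (e.2 - v.2) - w2 * (e.1 - v.1)) ^+ 2 by rewrite /sqd; ring.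
by rewrite d1 d2 expr0n addr0.
Qed.

End OneCircle.

(** On circle [i], every clipping arc contains the vertex, so each of its [sg] ends comes at or
    after the vertex. The running choice of the earliest end reaches the vertex at disk [j] and
    never leaves it. *)
Lemma vertex_corner p a r x : (forall i, (i < p)%N -> 0 < r i) ->
  vertex p a r x -> exists i sg, [/\ (i < p)%N, sg = 1 \/ sg = -1 &
    x = ((a i).1 + (arc_corner sg a r i p).1, (a i).2 + (arc_corner sg a r i p).2)].
Proof.
move=> r0 [Ox [i [j [ip jp [rji rij] xi xj]]]].
have [v xE v_rho] : exists2 v, ((a i).1 + v.1, (a i).2 + v.2) = x &
    v.1 ^+ 2 + v.2 ^+ 2 = r i ^+ 2.
  exists (x.1 - (a i).1, x.2 - (a i).2); last exact: xi.
  by rewrite /= !subrKC -surjective_pairing.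
have ri0 := r0 i ip; have rj0 := r0 j jp.
pose s := ((a j).1 - (a i).1) * v.2 - ((a j).2 - (a i).2) * v.1.
(* [sg] is the orientation for which the vertex is the end of the arc cut by disk [j]. *)
have [sg [sg1 sgs]] : exists sg : R, (sg = 1 \/ sg = -1) /\ 0 <= sg * s.
  case: (lerP 0 s) => h; first by exists 1; rewrite mul1r; split => //; left.
  by exists (- 1); rewrite mulN1r oppr_ge0 ltW//; split => //; right.
have clipj : clips (a i) (r i) (a j) (r j).
  by apply: (@mem_clips _ _ ri0 v) => //; rewrite xE xj.
have ejv : arc_end sg (a i) (r i) (a j) (r j) = v.
  by apply: arc_end_mem => //; rewrite xE.
have after l : (l < p)%N -> clips (a i) (r i) (a l) (r l) ->
   let e := arc_end sg (a i) (r i) (a l) (r l) in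
   0 <= sg * (v.1 * e.2 - v.2 * e.1) /\ (sg * (v.1 * e.2 - v.2 * e.1) <= 0 -> e = v).
  by move=> lp cl; apply: arc_end_after => //; [exact: r0 | rewrite xE; exact: Ox].
suff H n : (n <= p)%N -> let u := arc_corner sg a r i n in
    0 <= sg * (v.1 * u.2 - v.2 * u.1) /\ ((j < n)%N -> u = v).
  by exists i, sg; split => //; have [_ ->] := H p (leqnn p).
elim: n => [_|n IH np /=]; first by rewrite /= !mulr0 subrr mulr0.
have [IH1 IH2] := IH (ltnW np); rewrite /arc_step.
case: ifP => [/andP[cl ue]|Hn]; last first.
  split => //; rewrite ltnS leq_eqVlt => /orP[/eqP jn|//].
  (* At index [j] the proposed end is [v] itself, and the invariant makes the comparison accept
     it. *)
  move: Hn; rewrite -jn clipj ejv /=; rewrite -jn in IH1.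
  set u := arc_corner _ _ _ _ _ in IH1 *.
  by move/negbT; rewrite -ltNge => h; exfalso; lra.
have [h1 h2] := after n np cl; split => //.
rewrite ltnS leq_eqVlt => /orP[/eqP <-//|jn].
by apply: h2; rewrite -(IH2 jn).
Qed.

End Arcs.

(** * Chrystal's walk *)

Section Walk.
Variable R : realType.
Implicit Types (A B c q u v z : R * R) (s t : R).

Definition dot u v := u.1 * v.1 + u.2 * v.2.

Definition psub u v : R * R := (u.1 - v.1, u.2 - v.2).

Definition descent A B c : R * R :=
  ((A.1 + B.1) / 2 - c.1, (A.2 + B.2) / 2 - c.2).

Definition shift_center c s (d : R * R) : R * R := (c.1 + s * d.1, c.2 + s * d.2).

(** The difference of the squared distances of [v] and [A] to the moving center is affine in time;
    this is its zero. *)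
Definition hit_time A B c v : R :=
  (sqd A c - sqd v c) / (2 * dot (descent A B c) (psub A v)).

(* v is on the side of the chord AB towards which the center c moves. *)
Definition beyond A B c v : bool := 0 <= dot (descent A B c) (psub v A).

Lemma in_frame (f u : R * R) : f.1 ^+ 2 + f.2 ^+ 2 != 0 ->
  exists x y, u.1 = x * f.1 - y * f.2 /\ u.2 = x * f.2 + y * f.1.
Proof.
move=> f0; exists (dot u f / (f.1 ^+ 2 + f.2 ^+ 2)).
exists ((u.2 * f.1 - u.1 * f.2) / (f.1 ^+ 2 + f.2 ^+ 2)).
by rewrite /dot; split; field.
Qed.

(** Here [A = (0, -l)], [B = (0, l)], the old center is [(1, 0)] and the new one [(t, 0)]; [y] is
    the hit point, with a right or obtuse angle at [B]. Then [|v2| <= |l| <= |y2|] and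
    [y1 <= 2 * t], so both products in the conclusion are nonnegative. *)
Lemma beyond_frame (l t v1 v2 y1 y2 : R) : 0 < t ->
  v1 ^+ 2 + v2 ^+ 2 <= 2 * v1 + l ^+ 2 -> v1 <= 0 ->
  y1 ^+ 2 + y2 ^+ 2 = 2 * t * y1 + l ^+ 2 -> 0 < y1 -> l ^+ 2 <= l * y2 ->
  0 <= (y1 / 2 - t) * v1 + (y2 - l) / 2 * (v2 + l).
Proof.
move=> t0 hv v10 hy y10 ly.
have hv2 : v2 ^+ 2 <= l ^+ 2 by nra.
have hy2 : l ^+ 2 <= y2 ^+ 2.
  by have := sqr_ge0 (y2 - l); nra.
have hy1 : y1 <= 2 * t.
  by rewrite -(ler_pM2l y10); nra.
have lv : 0 <= l * (v2 + l).
  by rewrite mulrDr -lerBlDl sub0r lerNl -expr2; have := sqr_ge0 (v2 + l); nra.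
have h1 : 0 <= (y1 / 2 - t) * v1 by rewrite mulr_le0//; lra.
suff : 0 <= (y2 - l) * (v2 + l) by lra.
have [l0|l0|l0] := ltgtP l 0.
- by rewrite nmulr_rge0 in lv => //; apply: mulr_le0 => //; nra.
- by rewrite pmulr_rge0 in lv => //; apply: mulr_ge0 => //; nra.
- have : v2 ^+ 2 <= 0 by rewrite l0 expr0n in hv2.
  by rewrite real_exprn_even_le0//= => /eqP ->; rewrite l0 addr0 mulr0.
Qed.

(** The circumcenter of an acute triangle is in its convex hull, so no direction [e] has positive
    inner products with all three radius vectors. *)
Lemma acute_frame (l t y1 y2 e1 e2 : R) : 0 < t ->
  y1 ^+ 2 + y2 ^+ 2 = 2 * t * y1 + l ^+ 2 -> 0 < y1 ->
  l * y2 < l ^+ 2 -> - l ^+ 2 < l * y2 ->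
  0 < - t * e1 - l * e2 -> 0 < - t * e1 + l * e2 ->
  0 < (y1 - t) * e1 + y2 * e2 -> False.
Proof.
move=> t0 hy y10 ly1 ly2 h1 h2 h3.
have e10 : e1 < 0 by nra.
have hy2 : y2 ^+ 2 <= l ^+ 2.
  have : (l * y2) ^+ 2 <= (l ^+ 2) ^+ 2 by nra.
  rewrite exprMn [X in _ <= X]expr2 ler_pM2l//; nra.
have hy1 : 2 * t <= y1 by rewrite -(ler_pM2l y10); nra.
have : y2 * e2 <= - t * e1.
  have h4 : (y2 * e2) ^+ 2 <= (- t * e1) ^+ 2.
    apply: (@le_trans _ _ ((l * e2) ^+ 2)); last by nra.
    by rewrite !exprMn ler_wpM2r ?sqr_ge0.
  case: (lerP (y2 * e2) 0) => h; first by nra.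
  by rewrite -ler_sqr ?nnegrE ?(ltW h)//; nra.
nra.
Qed.

Lemma descentC A B c : descent A B c = descent B A c.
Proof. by rewrite /descent (addrC A.1) (addrC A.2). Qed.

Lemma dot_descent A B c : sqd B c = sqd A c ->
  dot (descent A B c) (psub A B) = 0.
Proof. by rewrite /sqd /dot /descent /psub /= => h; lra. Qed.

Lemma beyondC A B c v : sqd B c = sqd A c -> beyond B A c v = beyond A B c v.
Proof.
move=> /dot_descent h; rewrite /beyond descentC.
suff -> : dot (descent A B c) (psub v B) = dot (descent A B c) (psub v A) by [].
by rewrite -[RHS]addr0 -h /dot /psub /=; ring.
Qed.

Lemma hit_timeC A B c v : sqd B c = sqd A c -> hit_time B A c v = hit_time A B c v.
Proof.
move=> AB; have h := dot_descent AB; rewrite /hit_time descentC AB.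
congr (_ / (2 * _)); rewrite -[LHS]addr0 -h /dot /psub /=; ring.
Qed.

Lemma beyond_hit A B c q : (0 < dot (descent A B c) (psub A q)) = ~~ beyond A B c q.
Proof.
rewrite -ltNge -oppr_lt0.
suff -> : - dot (descent A B c) (psub A q) = dot (descent A B c) (psub q A) by [].
by rewrite /dot /psub /=; ring.
Qed.

Lemma beyond_last A q c : sqd q c = sqd A c -> beyond A q c q.
Proof.
by move=> qA; rewrite -beyondC// /beyond /dot /psub /= !subrr !mulr0 addr0.
Qed.

Section OneStep.
Variables (A B c q : R * R) (s : R).
Let d := descent A B c.
Let c' := shift_center c s d.
Hypothesis AB : sqd B c = sqd A c.

(** The terms quadratic in [s] cancel, which makes hit times the result of a single division. *)
Lemma sqd_move v : sqd v c' - sqd A c' = sqd v c - sqd A c + s * (2 * dot d (psub A v)).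
Proof. by rewrite /c' /shift_center /sqd /dot /psub /=; ring. Qed.

Lemma move_enclose v : 0 <= s ->
  (0 < dot d (psub A v) -> s <= hit_time A B c v) ->
  sqd v c <= sqd A c -> sqd v c' <= sqd A c'.
Proof.
move=> s0 hs vA; rewrite -subr_le0 sqd_move.
case: (ltrP 0 (dot d (psub A v))) => [/[dup] g0 /hs|g0].
  by rewrite /hit_time ler_pdivlMr ?mulr_gt0// => h; lra.
have h : 0 <= s * (2 * - dot d (psub A v)) by rewrite !mulr_ge0 ?oppr_ge0.
by rewrite mulrN mulrN in h; lra.
Qed.

Lemma move_chord : sqd B c' = sqd A c'.
Proof.
apply/eqP; rewrite -subr_eq0 sqd_move dot_descent// AB; apply/eqP; ring.
Qed.

(** The parallelogram identity: the squared distances from [z] to [A] and [B] sum to at least twice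
    the squared radius. *)
Lemma stop_midpoint z : s = 1 -> sqd A c' <= sqd A z \/ sqd A c' <= sqd B z.
Proof.
move=> s1; have [|h1] := lerP (sqd A c') (sqd A z); [by left|right].
have h2 : sqd A z + sqd B z = 2 * sqd A c' + 2 * sqd z c'.
  by rewrite /c' /shift_center s1 /d /descent /sqd /=; field.
by have := sqd_ge0 z c'; lra.
Qed.

Hypotheses (q_hit : ~~ beyond A B c q) (s_hit : s = hit_time A B c q) (s1 : s < 1).

Lemma move_hit : sqd q c' = sqd A c'.
Proof.
have := q_hit; rewrite -beyond_hit => g0; apply/eqP; rewrite -subr_eq0 sqd_move.
rewrite s_hit /hit_time divfK; last by rewrite mulf_neq0// gt_eqF.
by apply/eqP; ring.
Qed.

Let f := psub c ((A.1 + B.1) / 2, (A.2 + B.2) / 2).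
Let F := f.1 ^+ 2 + f.2 ^+ 2.

Let F0 : 0 < F.
Proof.
have := q_hit; rewrite -beyond_hit => g0.
(* If the center were already the midpoint, the descent would vanish and nothing could be hit. *)
rewrite lt0r addr_ge0 ?sqr_ge0// andbT.
apply: contraTneq g0; rewrite -leNgt /F /dot /descent /psub /=.
move=> /eqP; rewrite paddr_eq0 ?sqr_ge0// !sqrf_eq0 !subr_eq0 => /andP[/eqP-> /eqP->].
by rewrite !subrr !mul0r addr0.
Qed.

(* Coordinates with origin the midpoint of [A, B] and first axis through c;
   the line AB is the second axis, and B = (0, l). *)
Let frame : exists2 l, B.1 - A.1 = - 2 * l * f.2 /\ B.2 - A.2 = 2 * l * f.1 &
  forall v, exists x y, v.1 = (A.1 + B.1) / 2 + (x * f.1 - y * f.2) /\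
    v.2 = (A.2 + B.2) / 2 + (x * f.2 + y * f.1).
Proof.
have [x [l [E1 E2]]] := @in_frame f (psub B ((A.1 + B.1) / 2, (A.2 + B.2) / 2))
  (lt0r_neq0 F0).
exists l; last first.
  move=> v; have [x' [y' [E1' E2']]] :=
    @in_frame f (psub v ((A.1 + B.1) / 2, (A.2 + B.2) / 2)) (lt0r_neq0 F0).
  by exists x', y'; rewrite -E1' -E2' /psub /= !subrKC.
have : dot d (psub A B) = 0 by exact: dot_descent.
have -> : dot d (psub A B) = 2 * (f.1 * (x * f.1 - l * f.2) + f.2 * (x * f.2 + l * f.1)).
  by rewrite -E1 -E2 /d /descent /dot /f /psub /=; field.
have -> : f.1 * (x * f.1 - l * f.2) + f.2 * (x * f.2 + l * f.1) = x * F.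
  by rewrite /F; ring.
move/eqP; rewrite mulf_eq0 pnatr_eq0 /= mulf_eq0 (gt_eqF F0) orbF => /eqP x0.
move: E1 E2; rewrite x0 !mul0r sub0r add0r /psub /= => E1 E2; split; lra.
Qed.

Let coordinates : exists M g : R * R, exists l,
  [/\ 0 < g.1 ^+ 2 + g.2 ^+ 2,
    A = (M.1 + l * g.2, M.2 - l * g.1), B = (M.1 - l * g.2, M.2 + l * g.1),
    c = (M.1 + g.1, M.2 + g.2) &
    forall v, exists x y, v = (M.1 + (x * g.1 - y * g.2), M.2 + (x * g.2 + y * g.1))].
Proof.
have [l [B1 B2] Hv] := frame.
exists ((A.1 + B.1) / 2, (A.2 + B.2) / 2), f, l; split; first exact: F0.
- rewrite [LHS]surjective_pairing; move: B1 B2; move: (f.1) (f.2) => f1 f2 B1 B2.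
  by congr pair => /=; lra.
- rewrite [LHS]surjective_pairing; move: B1 B2; move: (f.1) (f.2) => f1 f2 B1 B2.
  by congr pair => /=; lra.
- by rewrite [LHS]surjective_pairing /f /psub /= !subrKC.
- move=> v; have [x [y [v1 v2]]] := Hv v; exists x, y.
  by rewrite [LHS]surjective_pairing v1 v2.
Qed.

Let t0 : 0 < 1 - s. Proof. by rewrite subr_gt0. Qed.

Lemma step_beyond v : dot (psub A B) (psub q B) <= 0 ->
  sqd v c <= sqd A c -> beyond A B c v -> beyond A q c' v.
Proof.
have [M [g [l [g0 EA EB Ec Ev]]]] := coordinates.
have [y1 [y2 Eq]] := Ev q; have [v1 [v2 Ev']] := Ev v.
have := move_hit; have := q_hit; rewrite -beyond_hit.
rewrite /beyond /c' /d /descent /shift_center Ec Eq Ev' EA EB /sqd /dot /psub /=.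
(* Each hypothesis is [G] times its normalized form, in which the old center is [(1, 0)]. *)
set G := g.1 ^+ 2 + g.2 ^+ 2 in g0.
move=> hq hm hB hv hb.
have y10 : 0 < y1.
  by rewrite -(pmulr_rgt0 _ g0); move: hq; rewrite /G; lra.
have yE : y1 ^+ 2 + y2 ^+ 2 = 2 * (1 - s) * y1 + l ^+ 2.
  apply: (mulfI (lt0r_neq0 g0)); move: hm; rewrite /G; lra.
have ly : l ^+ 2 <= l * y2.
  by rewrite -(ler_pM2l g0); move: hB; rewrite /G; lra.
have vE : v1 ^+ 2 + v2 ^+ 2 <= 2 * v1 + l ^+ 2.
  by rewrite -(ler_pM2l g0); move: hv; rewrite /G; lra.
have v10 : v1 <= 0.
  by rewrite -(pmulr_rle0 _ g0); move: hb; rewrite /G; lra.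
have := beyond_frame t0 vE v10 yE y10 ly.
by rewrite -(pmulr_rge0 _ g0) /G; lra.
Qed.

Lemma stop_acute z : 0 < dot (psub A B) (psub q B) -> 0 < dot (psub B A) (psub q A) ->
  [\/ sqd A c' <= sqd A z, sqd A c' <= sqd B z | sqd A c' <= sqd q z].
Proof.
move=> aB aA; have [|zA] := lerP (sqd A c') (sqd A z); first by constructor 1.
have [|zB] := lerP (sqd A c') (sqd B z); first by constructor 2.
have [|zq] := lerP (sqd A c') (sqd q z); first by constructor 3.
exfalso; move: zA zB zq aA aB.
have := sqd_ge0 z c'.
have [M [g [l [g0 EA EB Ec Ev]]]] := coordinates.
have [y1 [y2 Eq]] := Ev q; have [z1 [z2 Ez]] := Ev z.
have := move_hit; have := q_hit; rewrite -beyond_hit.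
rewrite /c' /d /descent /shift_center Ec Eq Ez EA EB /sqd /dot /psub /=.
set G := g.1 ^+ 2 + g.2 ^+ 2 in g0.
move=> hq hm z0 zA zB zq aA aB.
have y10 : 0 < y1.
  by rewrite -(pmulr_rgt0 _ g0); move: hq; rewrite /G; lra.
have yE : y1 ^+ 2 + y2 ^+ 2 = 2 * (1 - s) * y1 + l ^+ 2.
  apply: (mulfI (lt0r_neq0 g0)); move: hm; rewrite /G; lra.
have ly : l * y2 < l ^+ 2.
  by rewrite -(ltr_pM2l g0); move: aB; rewrite /G; lra.
have ly' : - l ^+ 2 < l * y2.
  by rewrite -(ltr_pM2l g0); move: aA; rewrite /G; lra.
(* With [e = z - c'], a point of the circle strictly closer to [z] than to [c'] has positive inner
   product with [e]. *)
apply: (acute_frame t0 yE y10 ly ly' (e1 := z1 - (1 - s)) (e2 := z2)).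
- by rewrite -(pmulr_rgt0 _ g0); move: z0 zA; rewrite /G; lra.
- by rewrite -(pmulr_rgt0 _ g0); move: z0 zB; rewrite /G; lra.
- by rewrite -(pmulr_rgt0 _ g0); move: z0 zq hm; rewrite /G; lra.
Qed.

End OneStep.

End Walk.

(** * Invariant and potential of the walk *)

Section WalkInvariant.
Variables (R : realType) (m : nat) (v : nat -> R * R).
Implicit Types (A B c q z : R * R) (s : R).

Definition walk_inv A B c : Prop :=
  [/\ exists2 k, (k < m)%N & A = v k, exists2 k, (k < m)%N & B = v k,
      sqd B c = sqd A c & forall k, (k < m)%N -> sqd (v k) c <= sqd A c].

Definition walk_optimal A c : Prop :=
  forall z, exists2 k, (k < m)%N & sqd A c <= sqd (v k) z.

(** The potential of the walk: bounded by [m] and strictly increasing at every turn. *)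
Definition progress A B c : nat := #|[pred k : 'I_m | beyond A B c (v k)]|.

Lemma progress_le A B c : (progress A B c <= m)%N.
Proof. by rewrite -[leqRHS]card_ord max_card. Qed.

Lemma walk_invC A B c : walk_inv A B c -> walk_inv B A c.
Proof. by move=> [vA vB AB enc]; split => // k km; rewrite AB enc. Qed.

Lemma progressC A B c : sqd B c = sqd A c -> progress B A c = progress A B c.
Proof. by move=> AB; apply: eq_card => k; rewrite !inE beyondC. Qed.

Section Step.
Variables (A B c : R * R) (s : R).
Hypothesis inv : walk_inv A B c.
Hypothesis s0 : 0 <= s.
Hypothesis s_le : forall k, (k < m)%N ->
  0 < dot (descent A B c) (psub A (v k)) -> s <= hit_time A B c (v k).
Let c' := shift_center c s (descent A B c).

Lemma walk_move : walk_inv A B c'.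
Proof.
have [vA vB AB enc] := inv; split => //; first exact: move_chord.
by move=> k km; apply: move_enclose => //; [exact: s_le|exact: enc].
Qed.

Lemma walk_midpoint : s = 1 -> walk_optimal A c'.
Proof.
move=> s1 z; have [[i im Ai] [j jm Bj] AB enc] := inv.
have [h|h] := stop_midpoint A B c z s1; first by exists i; rewrite // -Ai.
by exists j; rewrite // -Bj.
Qed.

Variable k : nat.
Hypotheses (km : (k < m)%N) (k_hit : ~~ beyond A B c (v k)).
Hypotheses (s_hit : s = hit_time A B c (v k)) (s1 : s < 1).

Lemma walk_acute : 0 < dot (psub A B) (psub (v k) B) ->
  0 < dot (psub B A) (psub (v k) A) -> walk_optimal A c'.
Proof.
move=> aB aA z; have [[i im Ai] [j jm Bj] AB enc] := inv.
have [h|h|h] := stop_acute AB k_hit s_hit s1 z aB aA; last by exists k.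
  by exists i; rewrite // -Ai.
by exists j; rewrite // -Bj.
Qed.

(** Points beyond the old chord stay beyond the new one, and the hit point joins them, being an end
    of the new chord. *)
Lemma walk_turn : dot (psub A B) (psub (v k) B) <= 0 ->
  walk_inv A (v k) c' /\ (progress A B c < progress A (v k) c')%N.
Proof.
move=> oB; have [vA vB AB enc] := inv; have [_ _ _ enc'] := walk_move.
have qA : sqd (v k) c' = sqd A c' by exact: move_hit.
split; first by split => //; exists k.
apply/proper_card/properP; split.
  by apply/fintype.subsetP => j; rewrite !inE; apply: step_beyond => //; exact: enc.
by exists (Ordinal km); rewrite !inE ?beyond_last.
Qed.

End Step.
End WalkInvariant.

(** * Program logic *)

Section Logic.
Variable R : realType.
Implicit Types (s : state R) (c : prog).

(** Total evaluation; the partiality of [reval] is moved into the side condition [rsafe]. *)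
Fixpoint rval s e : R :=
  match e with
  | RLit k => k%:R
  | RGet b i => rmem s b (neval s i)
  | RAdd e1 e2 => rval s e1 + rval s e2
  | RSub e1 e2 => rval s e1 - rval s e2
  | RMul e1 e2 => rval s e1 * rval s e2
  | RDiv e1 e2 => rval s e1 / rval s e2
  | RSqrt e1 => Num.sqrt (rval s e1)
  end.

Fixpoint rsafe s e : Prop :=
  match e with
  | RLit _ | RGet _ _ => True
  | RAdd e1 e2 | RSub e1 e2 | RMul e1 e2 => rsafe s e1 /\ rsafe s e2
  | RDiv e1 e2 => [/\ rsafe s e1, rsafe s e2 & rval s e2 != 0]
  | RSqrt e1 => rsafe s e1 /\ 0 <= rval s e1
  end.

Lemma reval_safe s e : rsafe s e -> reval s e = Some (rval s e).
Proof.
elim: e => //= [e1 IH1 e2 IH2|e1 IH1 e2 IH2|e1 IH1 e2 IH2|e1 IH1 e2 IH2|e1 IH1].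
- by move=> [/IH1-> /IH2->].
- by move=> [/IH1-> /IH2->].
- by move=> [/IH1-> /IH2->].
- by move=> [/IH1-> /IH2-> /negPf h] /=; rewrite h.
- by move=> [/IH1-> h] /=; rewrite h.
Qed.

Fixpoint tval s t : bool :=
  match t with
  | NLe e1 e2 => (neval s e1 <= neval s e2)%N
  | RLe e1 e2 => rval s e1 <= rval s e2
  | TNot t1 => ~~ tval s t1
  end.

Fixpoint tsafe s t : Prop :=
  match t with
  | NLe _ _ => True
  | RLe e1 e2 => rsafe s e1 /\ rsafe s e2
  | TNot t1 => tsafe s t1
  end.

Lemma teval_safe s t : tsafe s t -> teval s t = Some (tval s t).
Proof.
elim: t => //= [e1 e2 [/reval_safe-> /reval_safe->]//|t IH /IH->//].
Qed.

Definition runs c s K (Q : state R -> Prop) : Prop :=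
  exists k s', [/\ exec c s k s', (k <= K)%N & Q s'].

Lemma runs_weaken c s K K' (Q Q' : state R -> Prop) :
  runs c s K Q -> (K <= K')%N -> (forall s', Q s' -> Q' s') -> runs c s K' Q'.
Proof.
move=> [k [s' [e le_k q]]] KK QQ; exists k, s'; split => //; last exact: QQ.
exact: leq_trans KK.
Qed.

Lemma runs_seq c1 c2 s K1 K2 (Q1 Q : state R -> Prop) :
  runs c1 s K1 Q1 -> (forall s1, Q1 s1 -> runs c2 s1 K2 Q) ->
  runs (Seq c1 c2) s (K1 + K2) Q.
Proof.
move=> [k1 [s1 [e1 le1 q1]]] /(_ s1 q1)[k2 [s2 [e2 le2 q2]]].
exists (k1 + k2)%N, s2; split => //; [exact: ExecSeq e1 e2|exact: leq_add].
Qed.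

Lemma runs_if t c1 c2 s K (Q : state R -> Prop) : tsafe s t ->
  (tval s t -> runs c1 s K Q) -> (~~ tval s t -> runs c2 s K Q) ->
  runs (If t c1 c2) s (tcost t + K) Q.
Proof.
move=> /teval_safe tE H1 H2; case tv: (tval s t) in tE.
  have [k [s' [e le_k q]]] := H1 tv.
  by exists (tcost t + k)%N, s'; split => //; [exact: ExecIfTrue|rewrite leq_add2l].
have [k [s' [e le_k q]]] := H2 (negbT tv).
by exists (tcost t + k)%N, s'; split => //; [exact: ExecIfFalse|rewrite leq_add2l].
Qed.

(** The variant [mu] bounds the number of rounds; the extra unit pays for the final failing test. *)
Lemma runs_while t c s K (mu : state R -> nat) (I : state R -> Prop) :
  (forall s, I s -> tsafe s t) ->
  (forall s, I s -> tval s t -> runs c s K (fun s' => I s' /\ (mu s' < mu s)%N)) ->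
  I s -> runs (While t c) s ((mu s).+1 * (tcost t + K))
           (fun s' => I s' /\ ~~ tval s' t).
Proof.
move=> tI cI; have [n] := ubnP (mu s); elim: n s => // n IH s le_n Is.
have tE := teval_safe (tI s Is); case tv: (tval s t) in tE; last first.
  exists (tcost t), s; split; [exact: ExecWhileFalse| |by rewrite tv].
  by rewrite mulSn -addnA leq_addr.
have [k1 [s1 [e1 le1 [I1 mu1]]]] := cI s Is tv.
have [|k2 [s2 [e2 le2 q2]]] := IH s1 _ I1; first exact: leq_trans mu1 _.
exists (tcost t + k1 + k2)%N, s2; split=> //; first exact: ExecWhileTrue e1 e2.
rewrite mulSn leq_add ?leq_add2l//; apply: (leq_trans le2).
by rewrite leq_mul2r mu1 orbT.
Qed.

(* For loop-free programs only: a loop has precondition False and cost 0. *)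
Fixpoint wp c s (Q : state R -> Prop) : Prop :=
  match c with
  | Skip => Q s
  | NSet b i e => Q (State (upd (nmem s) b (neval s i) (neval s e)) (rmem s))
  | RSet b i e =>
      rsafe s e /\ Q (State (nmem s) (upd (rmem s) b (neval s i) (rval s e)))
  | Seq c1 c2 => wp c1 s (fun s1 => wp c2 s1 Q)
  | If t c1 c2 => tsafe s t /\ if tval s t then wp c1 s Q else wp c2 s Q
  | While _ _ => False
  end.

Arguments wp : simpl never.

Lemma wp_if t c1 c2 s Q : tsafe s t ->
  (tval s t -> wp c1 s Q) -> (~~ tval s t -> wp c2 s Q) -> wp (If t c1 c2) s Q.
Proof. by move=> ts H1 H2; split => //; case: (tval s t) H1 H2 => H1 H2; auto. Qed.

(** A conditional is charged for both branches, which keeps the bound independent of the state. *)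
Fixpoint pcost c : nat :=
  match c with
  | Skip => 1
  | NSet _ i e => (ncost i + ncost e).+1
  | RSet _ i e => (ncost i + rcost e).+1
  | Seq c1 c2 => pcost c1 + pcost c2
  | If t c1 c2 => tcost t + (pcost c1 + pcost c2)
  | While _ _ => 0
  end.

Lemma wp_runs c s Q : wp c s Q -> runs c s (pcost c) Q.
Proof.
elim: c s Q => [|b i e|b i e|c1 IH1 c2 IH2|t c1 IH1 c2 IH2|//] s Q; rewrite /wp -/wp /=.
- by exists 1, s; split => //; exact: ExecSkip.
- by eexists; eexists; split; [exact: ExecNSet| |].
- move=> [/reval_safe eE q].
  by eexists; eexists; split; [exact: ExecRSet eE| |].
- by move=> /IH1 h; apply: (runs_seq h) => s1 /IH2.
- move=> [ts h]; apply: runs_if => // tv; move: h; rewrite ?tv ?(negPf tv).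
    by move=> /IH1 /runs_weaken; apply; rewrite ?leq_addr.
  by move=> /IH2 /runs_weaken; apply; rewrite ?leq_addl.
Qed.

Fixpoint nwrites c : seq nat :=
  match c with
  | NSet b _ _ => [:: b]
  | Seq c1 c2 | If _ c1 c2 => nwrites c1 ++ nwrites c2
  | While _ c1 => nwrites c1
  | _ => [::]
  end.

Fixpoint rwrites c : seq nat :=
  match c with
  | RSet b _ _ => [:: b]
  | Seq c1 c2 | If _ c1 c2 => rwrites c1 ++ rwrites c2
  | While _ c1 => rwrites c1
  | _ => [::]
  end.

(** A syntactic criterion for what survives a subprogram, so that specifications only mention what
    is computed. *)
Definition frame c s s' : Prop :=
  (forall b, b \notin nwrites c -> nmem s' b = nmem s b) /\
  (forall b, b \notin rwrites c -> rmem s' b = rmem s b).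

Lemma exec_frame c s k s' : exec c s k s' -> frame c s s'.
Proof.
elim=> {c s k s'} //=.
- move=> s b i e; split => //= b'; rewrite inE => /negPf h.
  by apply/funext => j; rewrite /upd h.
- move=> s b i e v _; split => //= b'; rewrite inE => /negPf h.
  by apply/funext => j; rewrite /upd h.
- move=> c1 c2 s1 s2 s3 k1 k2 _ [n1 r1] _ [n2 r2]; split => b /=;
    rewrite mem_cat negb_or => /andP[h1 h2].
    by rewrite n2// n1.
  by rewrite r2// r1.
- move=> t c1 c2 s s' k _ _ [n1 r1]; split => b /=;
    rewrite mem_cat negb_or => /andP[h1 h2]; [exact: n1|exact: r1].
- move=> t c1 c2 s s' k _ _ [n1 r1]; split => b /=;
    rewrite mem_cat negb_or => /andP[h1 h2]; [exact: n1|exact: r1].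
- move=> t c s1 s2 s3 k1 k2 _ _ [n1 r1] _ [n2 r2]; split => b /= h.
    by rewrite n2// n1.
  by rewrite r2// r1.
Qed.

Lemma runs_frame c s K Q :
  runs c s K Q -> runs c s K (fun s' => Q s' /\ frame c s s').
Proof.
move=> [k [s' [e le_k q]]]; exists k, s'; split => //; split => //.
exact: exec_frame e.
Qed.

Definition nset s b (v : nat) : state R := State (upd (nmem s) b 0 v) (rmem s).

Definition for_loop b (bound : nat) c : prog :=
  Seq (NSet b (NLit 0) (NLit 0))
    (While (TNot (NLe (NGet bound (NLit 0)) (NGet b (NLit 0))))
      (Seq c (NSet b (NLit 0) (NAdd (NGet b (NLit 0)) (NLit 1))))).

(** The invariant is required after the counter has been increased. The 15 covers 6 operations for
    the test, 6 for the increment and the 3 of the initialization, charged to every round. *)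
Lemma runs_for b bound c s N K (I : nat -> state R -> Prop) :
  b \notin nwrites c -> bound \notin b :: nwrites c -> nmem s bound 0 = N ->
  I 0 (nset s b 0) ->
  (forall i s1, (i < N)%N -> nmem s1 b 0 = i -> I i s1 ->
    runs c s1 K (fun s2 => I i.+1 (nset s2 b i.+1))) ->
  runs (for_loop b bound c) s (N.+1 * (K + 15)) (I N).
Proof.
move=> bc; rewrite inE negb_or => /andP[bdb bdc] sN I0 Istep.
pose J s1 := [/\ (nmem s1 b 0 <= N)%N, nmem s1 bound 0 = N & I (nmem s1 b 0) s1].
have J0 : J (nset s b 0).
  by split; rewrite /nset /= /upd ?eqxx//= (negPf bdb) sN.
have [|s1 [i_lt bdN Is] /= |k [s' [e le_k [[le_N bdN Is]]]]] :=
  @runs_while (TNot (NLe (NGet bound (NLit 0)) (NGet b (NLit 0))))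
    (Seq c (NSet b (NLit 0) (NAdd (NGet b (NLit 0)) (NLit 1)))) (nset s b 0)
    (K + 6)%N (fun s => (N - nmem s b 0)%N) J _ _ J0.
- by [].
- rewrite bdN -ltnNge => iN.
  have /runs_frame h := Istep _ s1 iN erefl Is.
  apply: (runs_seq h) => s2 [I2 [fn _]]; apply: wp_runs; rewrite /wp /=.
  rewrite (fn b bc) addn1; split; last first.
    by rewrite /upd !eqxx /= ltn_sub2l.
  split; rewrite /= /upd ?eqxx//= (negPf bdb)/=.
  by rewrite (fn bound bdc).
- move=> /=; rewrite negbK bdN => le_N'.
  have iN : nmem s' b 0 = N by apply/eqP; rewrite eqn_leq le_N.
  exists (3 + k)%N, s'; split; last by rewrite -iN.
    by apply: ExecSeq e; exact: (@ExecNSet _ s b (NLit 0) (NLit 0)).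
  apply: (@leq_trans (3 + N.+1 * (6 + (K + 6)))).
    by rewrite leq_add2l (leq_trans le_k)// /nset /= /upd !eqxx /= subn0.
  rewrite !mulSn; lia.
Qed.

End Logic.

Arguments wp : simpl never.

(** * The program *)

(* Names of the arrays; a scalar variable is cell 0 of its own array. *)
Local Notation PSIZE := 0%N.
Local Notation I_ := 1%N.
Local Notation J_ := 2%N.
Local Notation COUNT := 3%N.
Local Notation FLAG := 4%N.
Local Notation AX := 0%N.
Local Notation AY := 1%N.
Local Notation RAD := 2%N.
Local Notation VX := 4%N.
Local Notation VY := 5%N.
Local Notation UX := 6%N.
Local Notation UY := 7%N.
Local Notation WX := 8%N.
Local Notation WY := 9%N.
Local Notation WW := 10%N.
Local Notation KK := 11%N.
Local Notation DISC := 12%N.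
Local Notation HH := 13%N.
Local Notation EX := 14%N.
Local Notation EY := 15%N.
Local Notation SG := 16%N.
Local Notation QX := 17%N.
Local Notation QY := 18%N.
Local Notation GO := 5%N.
Local Notation HIT := 6%N.
Local Notation K_ := 8%N.
Local Notation AA1 := 20%N.
Local Notation AA2 := 21%N.
Local Notation BB1 := 22%N.
Local Notation BB2 := 23%N.
Local Notation CC1 := 24%N.
Local Notation CC2 := 25%N.
Local Notation DD1 := 26%N.
Local Notation DD2 := 27%N.
Local Notation SS := 28%N.
Local Notation RHO := 29%N.
Local Notation GG := 30%N.
Local Notation TT := 31%N.
Local Notation OUT := 3%N.
Local Notation OK := 7%N.
Local Notation MR := 34%N.
Local Notation MX := 35%N.
Local Notation MY := 36%N.

Local Notation "c1 ;; c2" := (Seq c1 c2) (at level 60, right associativity).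
Local Notation "b ':=n' e" := (NSet b (NLit 0) e) (at level 55).
Local Notation "b ':=r' e" := (RSet b (NLit 0) e) (at level 55).

Definition nreg b : nexp := NGet b (NLit 0).
Definition rreg b : rexp := RGet b (NLit 0).
Definition sqr_exp e : rexp := RMul e e.
Definition sqd_exp x y u v : rexp := RAdd (sqr_exp (RSub x u)) (sqr_exp (RSub y v)).

Section Programs.
Variable R : realType.
Implicit Types (s : state R) (a : nat -> R * R) (r : nat -> R).

Lemma rval_sqr s e : rval s (sqr_exp e) = rval s e ^+ 2.
Proof. by []. Qed.

Lemma rval_sqd s x y u v :
  rval s (sqd_exp x y u v) = sqd (rval s x, rval s y) (rval s u, rval s v).
Proof. by []. Qed.

Lemma tval_le s e1 e2 : tval s (RLe e1 e2) = (rval s e1 <= rval s e2).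
Proof. by []. Qed.

Definition has_input p a r s : Prop :=
  [/\ nmem s PSIZE 0 = p, forall k, rmem s AX k = (a k).1,
      forall k, rmem s AY k = (a k).2 & forall k, rmem s RAD k = r k].

Lemma has_input_frame p a r c s s' :
  PSIZE \notin nwrites c -> all (fun b => b \notin rwrites c) [:: AX; AY; RAD] ->
  frame c s s' -> has_input p a r s -> has_input p a r s'.
Proof.
move=> np /and4P[r0 r1 r2 _] [fn fr] [h1 h2 h3 h4].
by split; rewrite ?fn ?fr.
Qed.

Definition inside_step : prog :=
  If (RLe (sqd_exp (rreg QX) (rreg QY) (RGet AX (nreg J_)) (RGet AY (nreg J_)))
          (sqr_exp (RGet RAD (nreg J_))))
    Skip (FLAG :=n NLit 0).

Definition inside : prog := FLAG :=n NLit 1 ;; for_loop J_ PSIZE inside_step.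

(** [K] is chosen before the instance, which makes the bound uniform; the later cost lemmas have the
    same form. *)
Lemma inside_runs : exists K, forall p a r s, has_input p a r s ->
  runs inside s (K * p.+1)
    (fun s' => nmem s' FLAG 0 = `[< lens p a r (rmem s QX 0, rmem s QY 0) >]).
Proof.
exists (pcost inside_step + 18)%N => p a r s hin.
set q := (rmem s QX 0, rmem s QY 0).
pose I n s' := [/\ has_input p a r s', (rmem s' QX 0, rmem s' QY 0) = q &
  nmem s' FLAG 0 = `[< lens n a r q >]].
apply: (@runs_weaken _ _ _ (3 + p.+1 * (pcost inside_step + 15)) _ (I p)); last 2 first.
- by move: (pcost _) => K; lia.
- by move=> s' [].
apply: (@runs_seq _ _ _ _ 3 _ (fun s' => s' = nset s FLAG 1)).
  exact: (@wp_runs _ (FLAG :=n NLit 1)).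
move=> _ ->.
have [pE _ _ _] := hin.
apply: (@runs_for _ J_ PSIZE inside_step (nset s FLAG 1) p) => //.
  split => //; rewrite /nset /upd /=; suff -> : `[< lens 0 a r q >] = true by [].
  by apply/asboolP => i.
move=> n s1 n_lt jn [[h1 h2 h3 h4] hq hf].
have lensS : `[< lens n.+1 a r q >] = `[< lens n a r q >] && (sqd q (a n) <= r n ^+ 2).
  apply/asboolP/andP => [h|[/asboolP h h'] i]; last first.
    by rewrite ltnS leq_eqVlt => /orP[/eqP->//|]; exact: h.
  by split; [apply/asboolP => i i_lt; apply: h; exact: ltnW|exact: h].
apply/wp_runs/wp_if; rewrite ?tval_le ?rval_sqd ?rval_sqr //= jn h2 h3 h4.
  rewrite -surjective_pairing hq => h; split=> //.
  by rewrite lensS h andbT.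
rewrite -surjective_pairing hq => /negPf h; split=> //.
by rewrite lensS h andbF.
Qed.

Definition corner_clip : prog :=
  HH :=r RMul (rreg SG) (RSqrt (rreg DISC)) ;;
  EX :=r RDiv (RSub (RMul (rreg KK) (rreg WX)) (RMul (rreg HH) (rreg WY)))
              (RMul (RLit 2) (rreg WW)) ;;
  EY :=r RDiv (RAdd (RMul (rreg KK) (rreg WY)) (RMul (rreg HH) (rreg WX)))
              (RMul (RLit 2) (rreg WW)) ;;
  If (RLe (RMul (rreg SG) (RSub (RMul (rreg UX) (rreg EY)) (RMul (rreg UY) (rreg EX))))
          (RLit 0))
    (UX :=r rreg EX ;; UY :=r rreg EY) Skip.

(** The tests of [clips] are nested so that the division by [WW] and the root of [DISC] are reached
    only where they are defined. *)
Definition corner_step : prog :=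
  WX :=r RSub (RGet AX (nreg J_)) (RGet AX (nreg I_)) ;;
  WY :=r RSub (RGet AY (nreg J_)) (RGet AY (nreg I_)) ;;
  WW :=r sqd_exp (RGet AX (nreg J_)) (RGet AY (nreg J_))
                 (RGet AX (nreg I_)) (RGet AY (nreg I_)) ;;
  KK :=r RSub (RAdd (sqr_exp (RGet RAD (nreg I_))) (rreg WW))
              (sqr_exp (RGet RAD (nreg J_))) ;;
  DISC :=r RSub (RMul (RMul (RLit 4) (sqr_exp (RGet RAD (nreg I_)))) (rreg WW))
                (sqr_exp (rreg KK)) ;;
  If (RLe (RGet RAD (nreg J_)) (RGet RAD (nreg I_)))
    (If (RLe (rreg WW) (sqr_exp (RSub (RGet RAD (nreg I_)) (RGet RAD (nreg J_)))))
       Skip (If (RLe (RLit 0) (rreg DISC)) corner_clip Skip))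
    Skip.

Definition corner : prog :=
  UX :=r RLit 0 ;; UY :=r RLit 0 ;; for_loop J_ PSIZE corner_step.

Lemma corner_runs : exists K, forall p a r s sg i, has_input p a r s ->
  rmem s SG 0 = sg -> nmem s I_ 0 = i ->
  runs corner s (K * p.+1)
    (fun s' => (rmem s' UX 0, rmem s' UY 0) = arc_corner sg a r i p).
Proof.
exists (pcost corner_step + 21)%N => p a r s sg i hin sgE iE.
pose I n s' := [/\ has_input p a r s', rmem s' SG 0 = sg, nmem s' I_ 0 = i &
  (rmem s' UX 0, rmem s' UY 0) = arc_corner sg a r i n].
apply: (@runs_weaken _ _ _ (3 + (3 + p.+1 * (pcost corner_step + 15))) _ (I p)); last 2 first.
- by move: (pcost _) => K; lia.
- by move=> s' [].
apply: (@runs_seq _ _ _ _ 3 _ (fun s' => s' = State (nmem s) (upd (rmem s) UX 0 0))).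
  by apply: (@wp_runs _ (UX :=r RLit 0)); split.
move=> _ ->; set s0 := State _ _.
apply: (@runs_seq _ _ _ _ 3 _ (fun s' => s' = State (nmem s0) (upd (rmem s0) UY 0 0))).
  by apply: (@wp_runs _ (UY :=r RLit 0)); split.
move=> _ ->.
have [pE _ _ _] := hin.
apply: runs_for => //.
move=> n s1 n_lt jn [[h1 h2 h3 h4] hsg hi hu]; apply/wp_runs.
have next s' u : nmem s' = nmem s1 -> rmem s' SG = rmem s1 SG ->
    rmem s' AX = rmem s1 AX -> rmem s' AY = rmem s1 AY -> rmem s' RAD = rmem s1 RAD ->
    (rmem s' UX 0, rmem s' UY 0) = u -> arc_corner sg a r i n.+1 = u ->
    I n.+1 (nset s' J_ n.+1).
  move=> en e3 e4 e5 e6 uE cE; split.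
  - by split; rewrite /= ?en ?e4 ?e5 ?e6.
  - by rewrite /= e3.
  - by rewrite /= /upd /= en.
  - by rewrite cE -uE.
have cornerS : arc_corner sg a r i n.+1 =
   arc_step sg (a i) (r i) (rmem s1 UX 0, rmem s1 UY 0) (a n) (r n).
  by rewrite hu.
do 5 (split; first by []); cbv beta.
match goal with |- wp _ ?s _ => set s5 := s end.
have : [/\ rmem s5 WX 0 = (a n).1 - (a i).1, rmem s5 WY 0 = (a n).2 - (a i).2,
  rmem s5 WW 0 = sqd (a n) (a i), rmem s5 KK 0 = chord_num (a i) (r i) (a n) (r n) &
  rmem s5 DISC 0 = chord_disc (a i) (r i) (a n) (r n)].
  by rewrite /s5 /= /upd /= jn hi !h2 !h3 !h4.
have : [/\ nmem s5 = nmem s1, rmem s5 AX = rmem s1 AX, rmem s5 AY = rmem s1 AY &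
  rmem s5 RAD = rmem s1 RAD] /\ [/\ rmem s5 SG = rmem s1 SG, rmem s5 UX = rmem s1 UX &
  rmem s5 UY = rmem s1 UY] by [].
clearbody s5 => -[[en e0 e1 e2] [e16 e6 e7]] [wxE wyE wwE kkE discE].
rewrite -e6 -e7 /arc_step /clips in cornerS.
apply: wp_if; rewrite ?tval_le //= e2 en jn hi !h4 => le_r; last first.
  by apply: next => //; rewrite cornerS (negPf le_r).
rewrite le_r andTb in cornerS.
apply: wp_if; rewrite ?tval_le ?rval_sqr //= e2 en jn hi !h4 wwE => lt_w.
  by apply: next => //; rewrite cornerS ltNge lt_w.
rewrite -ltNge in lt_w; rewrite lt_w andTb in cornerS.
have ww0 : 2 * sqd (a n) (a i) != 0.
  by rewrite mulf_neq0// gt_eqF// (le_lt_trans (sqr_ge0 _) lt_w).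
apply: wp_if; rewrite ?tval_le //= discE => disc0; last first.
  by apply: next => //; rewrite cornerS (negPf disc0).
rewrite disc0 andTb in cornerS.
split; first by split => //=; rewrite discE.
split; first by split => //; rewrite /= /upd /= wwE.
split; first (by split => //; rewrite /= /upd /= wwE); cbv beta.
match goal with |- wp _ ?s _ => set s8 := s end.
have : (rmem s8 EX 0, rmem s8 EY 0) = arc_end sg (a i) (r i) (a n) (r n).
  by rewrite /s8 /= /upd /= wxE wyE wwE kkE discE e16 hsg.
have : [/\ nmem s8 = nmem s1, rmem s8 AX = rmem s1 AX, rmem s8 AY = rmem s1 AY &
  rmem s8 RAD = rmem s1 RAD] /\ [/\ rmem s8 SG = rmem s1 SG, rmem s8 UX = rmem s5 UX &
  rmem s8 UY = rmem s5 UY] by [].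
clearbody s8 => -[[en8 e08 e18 e28] [e168 e68 e78]] eE.
rewrite -e68 -e78 -eE in cornerS.
apply: wp_if; rewrite ?tval_le //= e168 hsg => turn.
  by do 2 (split; first by []); apply: next => //; rewrite cornerS turn.
by apply: next => //; rewrite cornerS (negPf turn).
Qed.

End Programs.

(** * Enumeration of the vertices *)

Section Collect.
Variable R : realType.
Implicit Types (s : state R) (a : nat -> R * R) (r : nat -> R).

Definition found s (x : R * R) : Prop :=
  exists2 k, (k < nmem s COUNT 0)%N & x = (rmem s VX k, rmem s VY k).

Definition corner_point sg a r i p : R * R :=
  ((a i).1 + (arc_corner sg a r i p).1, (a i).2 + (arc_corner sg a r i p).2).

Definition push : prog :=
  RSet VX (nreg COUNT) (rreg QX) ;; RSet VY (nreg COUNT) (rreg QY) ;;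
  COUNT :=n NAdd (nreg COUNT) (NLit 1).

Definition collect_step : prog :=
  corner ;;
  (QX :=r RAdd (RGet AX (nreg I_)) (rreg UX) ;;
   QY :=r RAdd (RGet AY (nreg I_)) (rreg UY)) ;;
  inside ;;
  If (NLe (NLit 1) (nreg FLAG)) push Skip.

Definition collect e : prog := SG :=r e ;; for_loop I_ PSIZE collect_step.

(** One pass for each orientation; -1 is computed as [0 - 1] because literals are natural
    numbers. *)
Definition collect_all : prog :=
  COUNT :=n NLit 0 ;; collect (RLit 1) ;; collect (RSub (RLit 0) (RLit 1)).

Lemma collect_step_runs : exists K, forall p a r s sg i, has_input p a r s ->
  rmem s SG 0 = sg -> nmem s I_ 0 = i ->
  runs collect_step s (K * p.+1) (fun s' =>
    [/\ has_input p a r s', rmem s' SG 0 = sg,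
        (nmem s' COUNT 0 <= (nmem s COUNT 0).+1)%N &
        forall x, found s' x <->
          found s x \/ (x = corner_point sg a r i p /\ lens p a r x)]).
Proof.
have [K1 corner_r] := corner_runs R; have [K2 inside_r] := inside_runs R.
pose c2 := QX :=r RAdd (RGet AX (nreg I_)) (rreg UX) ;;
   QY :=r RAdd (RGet AY (nreg I_)) (rreg UY).
pose c4 := If (NLe (NLit 1) (nreg FLAG)) push Skip.
exists (K1 + K2 + pcost c2 + pcost c4)%N => p a r s sg i hin hsg hi.
apply: (@runs_weaken _ _ _ (K1 * p.+1 + (pcost c2 + (K2 * p.+1 + pcost c4)))); last 2 first.
- by move: (pcost c2) (pcost c4) => x y; nia.
- by move=> s'; exact.
have /runs_frame := corner_r p a r s sg i hin hsg hi.
move=> /runs_seq; apply => s1 [u1 fr1].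
have in1 : has_input p a r s1 by apply: has_input_frame fr1 hin.
pose v := corner_point sg a r i p.
apply: (@runs_seq _ _ _ _ _ _ (fun s2 => [/\ nmem s2 = nmem s1,
   has_input p a r s2, rmem s2 SG = rmem s1 SG,
   rmem s2 VX = rmem s1 VX /\ rmem s2 VY = rmem s1 VY & (rmem s2 QX 0, rmem s2 QY 0) = v])).
  apply: wp_runs; do 2 (split; first by []); have [h1 h2 h3 h4] := in1.
  split=> //=; rewrite /upd /= fr1.1// hi h2 h3 /v /corner_point.
  by have -> : arc_corner sg a r i p = (rmem s1 UX 0, rmem s1 UY 0) by [].
move=> s2 [en in2 sg2 [vx2 vy2] q2].
have := inside_r p a r s2 in2; rewrite q2 => /runs_frame/runs_seq; apply=> s3 [f3 fr3].
have in3 : has_input p a r s3 by apply: has_input_frame fr3 in2.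
have fr13 : [/\ nmem s3 COUNT = nmem s COUNT, rmem s3 VX = rmem s VX,
  rmem s3 VY = rmem s VY, rmem s3 SG 0 = sg & (rmem s3 QX 0, rmem s3 QY 0) = v].
  by rewrite !fr3.1 // !fr3.2 // en vx2 vy2 sg2 !fr1.1// !fr1.2.
case: fr13 => cE vxE vyE sgE qE.
apply/wp_runs; apply: wp_if => //=; rewrite f3.
  rewrite lt0b => /asboolP vO.
  do 2 (split; first by []); rewrite /wp.
  match goal with |- context [has_input _ _ _ ?s] => set s4 := s end.
  have c4E : nmem s4 COUNT 0 = (nmem s COUNT 0).+1 by rewrite /s4 /= /upd /= cE addn1.
  have v4E k : (rmem s4 VX k, rmem s4 VY k) =
      if k == nmem s COUNT 0 then v else (rmem s VX k, rmem s VY k).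
    by rewrite /s4 /= /upd /= cE vxE vyE -qE; case: ifP.
  split => //; first by rewrite c4E.
  move=> x; rewrite /found c4E; split.
    move=> [k k_lt ->]; rewrite v4E; case: eqP => [_|kc]; first by right.
    by left; exists k => //; move: k_lt; rewrite ltnS leq_eqVlt => /orP[/eqP//|].
  case=> [[k k_lt ->]|[-> _]].
    by exists k; rewrite ?ltnS 1?ltnW// v4E (ltn_eqF k_lt).
  by exists (nmem s COUNT 0); rewrite // v4E eqxx.
rewrite lt0b => /asboolPn vO; split => //; first by rewrite cE.
move=> x; split; last first.
  case=> [[k k_lt ->]|[-> //]]; exists k; by rewrite ?cE ?vxE ?vyE.
by move=> [k k_lt ->]; left; exists k; rewrite -?cE -?vxE -?vyE.
Qed.

Lemma collect_runs : exists K, forall p a r s sg e, has_input p a r s ->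
  rsafe s e -> rval s e = sg ->
  runs (collect e) s (rcost e + K * p.+1 ^ 2) (fun s' =>
    [/\ has_input p a r s', (nmem s' COUNT 0 <= nmem s COUNT 0 + p)%N &
        forall x, found s' x <->
          found s x \/ lens p a r x /\ exists2 i, (i < p)%N & x = corner_point sg a r i p]).
Proof.
have [K step_r] := collect_step_runs.
exists (K + 17)%N => p a r s sg e hin se eE.
pose I n s' := [/\ has_input p a r s', rmem s' SG 0 = sg,
  (nmem s' COUNT 0 <= nmem s COUNT 0 + n)%N & forall x, found s' x <->
     found s x \/ lens p a r x /\ exists2 i, (i < n)%N & x = corner_point sg a r i p].
apply: (@runs_weaken _ _ _ ((1 + rcost e).+1 + p.+1 * (K * p.+1 + 15)) _ (I p)).
- apply: (@runs_seq _ _ _ _ _ _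
    (fun s' => s' = State (nmem s) (upd (rmem s) SG 0 sg))).
    by apply: (@wp_runs _ (SG :=r e)); split; rewrite // eE.
  move=> _ ->; have [pE _ _ _] := hin; apply: runs_for => //.
    split => //=; first by rewrite /upd /= addn0.
    by move=> x; split; [left|case=> // -[_ []]].
  move=> n s1 n_lt iE [in1 sg1 c1 f1].
  have := step_r p a r s1 sg n in1 sg1 iE.
  move=> /runs_weaken; apply => // s2 [in2 sg2 c2 f2]; split => //=.
    by rewrite /upd /= addnS (leq_trans c2).
  move=> x; have -> : found (nset s2 I_ n.+1) x = found s2 x by [].
  rewrite f2 f1; split=> [[[|[xO [i i_lt xE]]]|[xE xO]]|[|[xO [i]]]].
  + by left.
  + by right; split => //; exists i; first exact: ltnW.
  + by right; split => //; exists n.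
  + by left; left.
  + rewrite ltnS leq_eqVlt => /orP[/eqP->|i_lt] xE; first by right.
    by left; right; split => //; exists i.
- by nia.
- by move=> s' [].
Qed.

(** By [vertex_corner] the list contains all vertices. Other entries are harmless, since they too
    belong to the lens. *)
Lemma collect_all_runs : exists K, forall p a r s, has_input p a r s ->
  runs collect_all s (K * p.+1 ^ 2) (fun s' =>
    [/\ has_input p a r s', (nmem s' COUNT 0 <= 2 * p)%N &
        forall x, found s' x <-> lens p a r x /\ exists i sg,
          [/\ (i < p)%N, sg = 1 \/ sg = -1 & x = corner_point sg a r i p]]).
Proof.
have [K collect_r] := collect_runs.
exists (2 * K + 7)%N => p a r s hin.
apply: (@runs_weaken _ _ _ (3 + ((1 + K * p.+1 ^ 2) + (3 + K * p.+1 ^ 2)))); last 2 first.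
- by nia.
- by move=> s'; exact.
apply: (@runs_seq _ _ _ _ _ _ (fun s' => s' = nset s COUNT 0)).
  exact: (@wp_runs _ (COUNT :=n NLit 0)).
move=> _ ->; have in0 : has_input p a r (nset s COUNT 0) by [].
apply: runs_seq (collect_r p a r _ 1 (RLit 1) in0 I erefl) _ => s1 [in1 c1 f1].
have := collect_r p a r s1 (-1) (RSub (RLit 0) (RLit 1)) in1 (conj I I) (sub0r _).
move=> /runs_weaken; apply => // s2 [in2 c2 f2]; split => //.
  rewrite mul2n -addnn; apply: (leq_trans c2); rewrite leq_add2r.
  by apply: (leq_trans c1).
move=> x; rewrite f2 f1; split.
  move=> [[[k //]|[xO [i i_lt xE]]]|[xO [i i_lt xE]]]; split => //.
    by exists i, 1; split => //; left.
  by exists i, (-1); split => //; right.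
move=> [xO [i [sg [i_lt [->|->] xE]]]].
  by left; right; split => //; exists i.
by right; split => //; exists i.
Qed.

End Collect.

Definition dot_exp x1 x2 y1 y2 : rexp := RAdd (RMul x1 y1) (RMul x2 y2).

(** * Implementation of the walk *)

Section WalkProgram.
Variable R : realType.
Implicit Types (s : state R) (v : nat -> R * R).

Definition has_points m v s : Prop :=
  [/\ nmem s COUNT 0 = m, forall k, rmem s VX k = (v k).1 &
      forall k, rmem s VY k = (v k).2].

Definition pair_at s b1 b2 : R * R := (rmem s b1 0, rmem s b2 0).

Definition scan_step : prog :=
  GG :=r dot_exp (rreg DD1) (rreg DD2) (RSub (rreg AA1) (RGet VX (nreg K_)))
                 (RSub (rreg AA2) (RGet VY (nreg K_))) ;;
  If (RLe (rreg GG) (RLit 0)) Skip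
    (TT :=r RDiv (RSub (rreg RHO) (sqd_exp (RGet VX (nreg K_)) (RGet VY (nreg K_))
                                           (rreg CC1) (rreg CC2)))
                 (RMul (RLit 2) (rreg GG)) ;;
     If (RLe (rreg SS) (rreg TT)) Skip
       (SS :=r rreg TT ;; QX :=r RGet VX (nreg K_) ;; QY :=r RGet VY (nreg K_) ;;
        HIT :=n NLit 1)).

Definition scan_init : prog :=
  DD1 :=r RSub (RDiv (RAdd (rreg AA1) (rreg BB1)) (RLit 2)) (rreg CC1) ;;
  DD2 :=r RSub (RDiv (RAdd (rreg AA2) (rreg BB2)) (RLit 2)) (rreg CC2) ;;
  RHO :=r sqd_exp (rreg AA1) (rreg AA2) (rreg CC1) (rreg CC2) ;;
  SS :=r RLit 1 ;; HIT :=n NLit 0.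

Definition scan : prog := scan_init ;; for_loop K_ COUNT scan_step.

(** [HIT] separates the two kinds of stop: at 0 the midpoint is reached at time 1, otherwise a
    recorded point is hit earlier. *)
Definition scanned n m v A B c s : Prop :=
  let t := rmem s SS 0 in
  [/\ 0 <= t,
      forall k, (k < n)%N -> 0 < dot (descent A B c) (psub A (v k)) ->
        t <= hit_time A B c (v k),
      nmem s HIT 0 = 0 -> t = 1 &
      nmem s HIT 0 != 0 -> t < 1 /\ exists k,
        [/\ (k < m)%N, pair_at s QX QY = v k, ~~ beyond A B c (v k) &
            t = hit_time A B c (v k)]].

Lemma scan_runs : exists K, forall m v A B c s, has_points m v s ->
  pair_at s AA1 AA2 = A -> pair_at s BB1 BB2 = B -> pair_at s CC1 CC2 = c ->
  (forall k, (k < m)%N -> sqd (v k) c <= sqd A c) ->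
  runs scan s (K * m.+1) (fun s' =>
    [/\ has_points m v s', pair_at s' AA1 AA2 = A, pair_at s' BB1 BB2 = B,
        pair_at s' CC1 CC2 = c &
        pair_at s' DD1 DD2 = descent A B c /\ scanned m m v A B c s']).
Proof.
exists (pcost scan_init + (pcost scan_step + 15))%N => m v A B c s hp hA hB hc enc.
pose I n s' := [/\ has_points m v s', pair_at s' AA1 AA2 = A, pair_at s' BB1 BB2 = B,
  pair_at s' CC1 CC2 = c & [/\ pair_at s' DD1 DD2 = descent A B c,
  rmem s' RHO 0 = sqd A c & scanned n m v A B c s']].
apply: (@runs_weaken _ _ _ (pcost scan_init + m.+1 * (pcost scan_step + 15)) _ (I m)); last 2 first.
- by move: (pcost scan_init) (pcost _) => x y; nia.
- by move=> s' [? ? ? ? []].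
apply: (@runs_seq _ _ _ _ _ _ (I 0)).
  apply: wp_runs.
  split; first by rewrite /= pnatr_eq0.
  split; first by rewrite /= pnatr_eq0.
  do 2 (split; first by []).
  rewrite /wp; split; [by case: hp; split|by []|by []|by []|].
  rewrite -hA -hB -hc; split; [by []|by []|].
  by rewrite /scanned /= /upd /=; split=> //; exact: ler01.
move=> s0 I0; have [[hm _ _] _ _ _ _] := I0.
apply: runs_for => // n s1 n_lt kE [[h1 h2 h3] hA1 hB1 hc1 [hd hrho [t0 tle t1 thit]]].
apply: wp_runs; split; first by []; cbv beta.
match goal with |- wp _ ?s _ => set s2 := s end.
have gE : rmem s2 GG 0 = dot (descent A B c) (psub A (v n)).
  by rewrite /s2 /= /upd /= kE h2 h3 -hd -hA1.
have [en eq] : nmem s2 = nmem s1 /\ (forall b, b != GG -> rmem s2 b = rmem s1 b).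
  split => // b /negPf hb; apply/funext => j; by rewrite /s2 /= /upd hb.
clearbody s2.
have I_next s' : nmem s' COUNT = nmem s1 COUNT ->
    (forall b, b \notin [:: GG; TT; SS; QX; QY] -> rmem s' b = rmem s1 b) ->
    scanned n.+1 m v A B c s' -> I n.+1 (nset s' K_ n.+1).
  move=> e1 e2 sc; split; [|by rewrite /pair_at /= !e2..|].
    by split; rewrite /= /upd /= ?e2 ?e1.
  by split; rewrite /pair_at /= ?e2.
apply: wp_if; rewrite ?tval_le //= gE => g0.
  apply: I_next; first by rewrite en.
    by move=> b /=; rewrite !inE !negb_or => /and5P[hb _ _ _ _]; rewrite eq.
  rewrite /scanned /pair_at !eq// en; split => // k.
  rewrite ltnS leq_eqVlt => /orP[/eqP->|]; [by rewrite ltNge g0|exact: tle].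
rewrite -ltNge in g0.
split; first by split=> //; rewrite /= gE mulf_neq0 ?gt_eqF.
match goal with |- wp _ ?s _ => set s3 := s end.
have tE : rmem s3 TT 0 = hit_time A B c (v n).
  by rewrite /s3 /= /upd /= gE en kE !eq// h2 h3 hrho -hc1.
have [en3 eq3] : nmem s3 = nmem s1 /\
    (forall b, b \notin [:: GG; TT] -> rmem s3 b = rmem s1 b).
  split => // b; rewrite !inE negb_or => /andP[b1 b2]; rewrite -(eq b b1).
  by apply/funext => j; rewrite /s3 /= /upd (negPf b2).
clearbody s3.
apply: wp_if; rewrite ?tval_le //= tE eq3// => st.
  apply: I_next; first by rewrite en3.
    move=> b /=; rewrite !inE !negb_or => /and5P[b1 b2 _ _ _].
    by rewrite eq3// !inE negb_or b1.
  rewrite /scanned /pair_at !eq3// en3; split => // k.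
  by rewrite ltnS leq_eqVlt => /orP[/eqP->//|]; exact: tle.
rewrite -ltNge in st.
do 3 (split; first by []); rewrite /wp.
match goal with |- I _ (nset ?s _ _) => set s4 := s end.
have s4E : [/\ rmem s4 SS 0 = hit_time A B c (v n), pair_at s4 QX QY = v n,
    nmem s4 HIT 0 = 1%N & nmem s4 COUNT = nmem s1 COUNT].
  rewrite /s4 /= /pair_at /upd /= tE en3 kE !eq3//=; split => //.
  by rewrite h2 h3 -surjective_pairing.
have eq4 b : b \notin [:: GG; TT; SS; QX; QY] -> rmem s4 b = rmem s1 b.
  rewrite !inE !negb_or => /and5P[b1 b2 b3 b4 b5]; rewrite -(eq3 b) ?inE ?negb_or ?b1//.
  by apply/funext => j; rewrite /s4 /= /upd (negPf b3) (negPf b4) (negPf b5).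
clearbody s4; case: s4E => sE qE hE cE.
apply: I_next => //; rewrite /scanned sE hE qE; split => //.
- rewrite divr_ge0 ?mulr_ge0 ?(ltW g0)// subr_ge0; exact: enc.
- move=> k; rewrite ltnS leq_eqVlt => /orP[/eqP->//|k_lt g].
  by apply: le_trans (ltW st) _; exact: tle.
- move=> _; split; last by exists n; split; rewrite // -beyond_hit.
  apply: (lt_le_trans st); have [h0|h0] := eqVneq (nmem s1 HIT 0) 0; first by rewrite t1.
  by case: (thit h0) => /ltW.
Qed.

Definition walk_advance : prog :=
  CC1 :=r RAdd (rreg CC1) (RMul (rreg SS) (rreg DD1)) ;;
  CC2 :=r RAdd (rreg CC2) (RMul (rreg SS) (rreg DD2)).

(** A right or obtuse angle at [B] drops [B]. At [A], the end [B] first takes the place of [A], so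
    the hit point always becomes the second end. An acute triangle stops the walk. *)
Definition walk_pivot : prog :=
  If (NLe (nreg HIT) (NLit 0)) (GO :=n NLit 0)
    (If (RLe (dot_exp (RSub (rreg AA1) (rreg BB1)) (RSub (rreg AA2) (rreg BB2))
                      (RSub (rreg QX) (rreg BB1)) (RSub (rreg QY) (rreg BB2))) (RLit 0))
       (BB1 :=r rreg QX ;; BB2 :=r rreg QY)
       (If (RLe (dot_exp (RSub (rreg BB1) (rreg AA1)) (RSub (rreg BB2) (rreg AA2))
                         (RSub (rreg QX) (rreg AA1)) (RSub (rreg QY) (rreg AA2))) (RLit 0))
          (AA1 :=r rreg BB1 ;; AA2 :=r rreg BB2 ;;
           BB1 :=r rreg QX ;; BB2 :=r rreg QY)
          (GO :=n NLit 0))).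

Definition walk_step : prog := scan ;; walk_advance ;; walk_pivot.

Definition walk_state m v s : Prop :=
  [/\ has_points m v s,
      walk_inv m v (pair_at s AA1 AA2) (pair_at s BB1 BB2) (pair_at s CC1 CC2) &
      nmem s GO 0 = 0 -> walk_optimal m v (pair_at s AA1 AA2) (pair_at s CC1 CC2)].

(** The successor keeps the measure positive while the walk runs, so that stopping also decreases
    it. *)
Definition walk_measure m v s : nat :=
  if nmem s GO 0 is 0 then 0
  else (m - progress m v (pair_at s AA1 AA2) (pair_at s BB1 BB2) (pair_at s CC1 CC2)).+1.

Lemma walk_step_runs : exists K, forall m v s, walk_state m v s -> nmem s GO 0 != 0 ->
  runs walk_step s (K * m.+1) (fun s' =>
    walk_state m v s' /\ (walk_measure m v s' < walk_measure m v s)%N).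
Proof.
have [K scan_r] := scan_runs.
exists (K + (pcost walk_advance + pcost walk_pivot))%N => m v s [hp inv _] go.
set A := pair_at s AA1 AA2 in inv *; set B := pair_at s BB1 BB2 in inv *.
set c := pair_at s CC1 CC2 in inv *.
apply: (@runs_weaken _ _ _ (K * m.+1 + (pcost walk_advance + pcost walk_pivot))); last 2 first.
- by move: (pcost _) (pcost _) => x y; nia.
- by move=> s'; exact.
have [_ _ AB enc] := inv.
have /runs_frame := scan_r m v A B c s hp erefl erefl erefl enc.
move=> /runs_seq; apply=> s1 [[hp1 A1 B1 c1 [d1 [t0 tle t1 thit]]] fr1].
have go1 : nmem s1 GO 0 = nmem s GO 0 by rewrite fr1.1.
set t := rmem s1 SS 0 in t0 tle t1 thit.
have inv' := walk_move inv t0 tle; set c' := shift_center c t (descent A B c) in inv'.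
apply: (@runs_seq _ _ _ _ _ _ (fun s2 => [/\ nmem s2 = nmem s1,
  has_points m v s2, pair_at s2 AA1 AA2 = A /\ pair_at s2 BB1 BB2 = B,
  pair_at s2 CC1 CC2 = c' & pair_at s2 QX QY = pair_at s1 QX QY])).
  apply: wp_runs; do 2 (split; first by []); cbv beta.
  by split => //; rewrite /c' -d1 -c1.
move=> s2 [en hp2 [A2 B2] c2 q2]; apply: wp_runs.
have measE : walk_measure m v s = (m - progress m v A B c).+1.
  by rewrite /walk_measure; case: (nmem s GO 0) go.
have go2 : nmem s2 GO 0 != 0 by rewrite en go1.
have stop : walk_optimal m v A c' -> walk_state m v (State (upd (nmem s2) GO 0 0) (rmem s2)) /\
  (walk_measure m v (State (upd (nmem s2) GO 0 0) (rmem s2)) < walk_measure m v s)%N.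
  move=> opt; split; last by rewrite measE /walk_measure /= /upd.
  have -> : walk_state m v (State (upd (nmem s2) GO 0 0) (rmem s2)) =
    [/\ has_points m v s2, walk_inv m v A B c' & 0%N = 0%N -> walk_optimal m v A c'].
    by rewrite -A2 -B2 -c2.
  by [].
have turn s' A' B' : nmem s' = nmem s2 -> has_points m v s' ->
    pair_at s' AA1 AA2 = A' -> pair_at s' BB1 BB2 = B' -> pair_at s' CC1 CC2 = c' ->
    walk_inv m v A' B' c' -> (progress m v A B c < progress m v A' B' c')%N ->
    walk_state m v s' /\ (walk_measure m v s' < walk_measure m v s)%N.
  move=> en' hp' A3 B3 c3 inv3 prog3; split.
    split; [by []|by rewrite A3 B3 c3|].
    by move=> g; move: go2; rewrite -en' g.
  rewrite measE /walk_measure A3 B3 c3 en'.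
  case: (nmem s2 GO 0) go2 => // _ _.
  by have := progress_le m v A' B' c'; lia.
have hitE : nmem s2 HIT 0 = nmem s1 HIT 0 by rewrite en.
apply: wp_if; first by [].
  rewrite /= hitE leqn0 => /eqP h; apply: stop; apply: walk_midpoint inv (t1 h).
rewrite /= hitE -ltnNge lt0n => h; have [lt1 [k [km qE k_hit tE]]] := thit h.
have dotE x1 x2 y1 y2 x1' x2' y1' y2' u w u' w' : pair_at s2 x1 x2 = u ->
    pair_at s2 y1 y2 = w -> pair_at s2 x1' x2' = u' -> pair_at s2 y1' y2' = w' ->
    tval s2 (RLe (dot_exp (RSub (rreg x1) (rreg y1)) (RSub (rreg x2) (rreg y2))
            (RSub (rreg x1') (rreg y1')) (RSub (rreg x2') (rreg y2'))) (RLit 0)) =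
    (dot (psub u w) (psub u' w') <= 0).
  by move=> <- <- <- <-.
rewrite -q2 in qE.
apply: wp_if; first by []; rewrite (dotE _ _ _ _ _ _ _ _ _ _ _ _ A2 B2 qE B2) => oB.
  have [inv3 pr3] := walk_turn inv t0 tle km k_hit tE lt1 oB.
  do 2 (split; first by []); cbv beta.
  by apply: (@turn _ A (v k)) => //; case: hp2; split.
apply: wp_if; first by []; rewrite (dotE _ _ _ _ _ _ _ _ _ _ _ _ B2 A2 qE A2) => oA.
  (* Dropping [A] is the previous case with the chord ends exchanged. *)
  have dC := descentC B A c.
  have k_hit' : ~~ beyond B A c (v k) by rewrite beyondC.
  have tle' k' : (k' < m)%N -> 0 < dot (descent B A c) (psub B (v k')) ->
      t <= hit_time B A c (v k').
    rewrite beyond_hit beyondC// -beyond_hit hit_timeC//; exact: tle.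
  have tE' : t = hit_time B A c (v k) by rewrite hit_timeC.
  have [inv3 pr3] := walk_turn (walk_invC inv) t0 tle' km k_hit' tE' lt1 oA.
  rewrite dC -/c' progressC// in inv3 pr3.
  do 4 (split; first by []); cbv beta.
  by apply: (@turn _ B (v k)) => //; case: hp2; split.
rewrite -ltNge in oB; rewrite -ltNge in oA.
by apply: stop; exact: (walk_acute inv km k_hit tE lt1 oB oA).
Qed.

Definition walk_far : prog :=
  If (RLe (sqd_exp (RGet VX (nreg K_)) (RGet VY (nreg K_)) (rreg CC1) (rreg CC2))
          (sqd_exp (rreg AA1) (rreg AA2) (rreg CC1) (rreg CC2)))
    Skip (AA1 :=r RGet VX (nreg K_) ;; AA2 :=r RGet VY (nreg K_)).

Definition walk_init : prog :=
  CC1 :=r RLit 0 ;; CC2 :=r RLit 0 ;;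
  AA1 :=r RGet VX (NLit 0) ;; AA2 :=r RGet VY (NLit 0).

(** The walk begins on the degenerate chord [A = B], with [A] the listed point farthest from the
    origin. The center moves towards [A], and the first hit passes the angle test at [B] with value
    zero. *)
Definition walk_start : prog :=
  BB1 :=r rreg AA1 ;; BB2 :=r rreg AA2 ;; GO :=n NLit 1.

Definition walk : prog :=
  walk_init ;; for_loop K_ COUNT walk_far ;; walk_start ;;
  While (NLe (NLit 1) (nreg GO)) walk_step.

Lemma walk_runs : exists K, forall m v s, has_points m v s -> (0 < m)%N ->
  runs walk s (K * m.+1 ^ 2) (fun s' => [/\ has_points m v s',
    exists2 k, (k < m)%N & pair_at s' AA1 AA2 = v k,
    forall k, (k < m)%N ->
      sqd (v k) (pair_at s' CC1 CC2) <= sqd (pair_at s' AA1 AA2) (pair_at s' CC1 CC2) &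
    walk_optimal m v (pair_at s' AA1 AA2) (pair_at s' CC1 CC2)]).
Proof.
have [K step_r] := walk_step_runs.
exists (pcost walk_init + pcost walk_far + pcost walk_start + 15 + 2 * (4 + K))%N.
move=> m v s hp m0.
apply: (@runs_weaken _ _ _ (pcost walk_init + (m.+1 * (pcost walk_far + 15) +
  (pcost walk_start + m.+2 * (tcost (NLe (NLit 1) (nreg GO)) + K * m.+1))))); last 2 first.
- have -> : tcost (NLe (NLit 1) (nreg GO)) = 4 by [].
  by move: (pcost walk_init) (pcost walk_far) (pcost walk_start) => x y z; nia.
- by move=> s'; exact.
pose I n s' := [/\ has_points m v s',
  exists2 k, (k < m)%N & pair_at s' AA1 AA2 = v k &
  forall k, (k < n)%N ->
    sqd (v k) (pair_at s' CC1 CC2) <= sqd (pair_at s' AA1 AA2) (pair_at s' CC1 CC2)].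
apply: (@runs_seq _ _ _ _ _ _ (I 0)).
  apply: wp_runs; do 4 (split; first by []); rewrite /wp; case: hp => h1 h2 h3.
  split => //; exists 0 => //; rewrite /pair_at /= /upd /= h2 h3.
  by rewrite -surjective_pairing.
move=> s0 I0; apply: (@runs_seq _ _ _ _ _ _ (I m)).
  have [[hm _ _] _ _] := I0.
  apply: runs_for => // n s1 n_lt kE [[h1 h2 h3] [j jm Aj] le_far].
  have vE : (rmem s1 VX n, rmem s1 VY n) = v n.
    by rewrite h2 h3 -surjective_pairing.
  apply: wp_runs; apply: wp_if; first by [].
    rewrite tval_le !rval_sqd /= kE vE => h; split; [by split|by exists j|] => k.
    by rewrite ltnS leq_eqVlt => /orP[/eqP->//|]; exact: le_far.
  rewrite tval_le !rval_sqd /= kE vE -ltNge => h.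
  do 2 (split; first by []); cbv beta; rewrite /= kE.
  split; [by split|by exists n|] => k.
  rewrite /pair_at /= /upd /= vE ltnS leq_eqVlt => /orP[/eqP->//|k_lt].
  by apply: le_trans (ltW h); exact: le_far.
move=> s2 [hp2 vA enc].
apply: (@runs_seq _ _ _ _ _ _ (fun s3 => walk_state m v s3 /\ nmem s3 GO 0 = 1%N)).
  apply: wp_runs; do 2 (split; first by []); rewrite /wp; split => //.
move=> s3 [ws3 go3].
have [//|s4 ws4 go4|k [s4 [e le_k [[hp4 [vA4 _ _ enc4] opt4] go4]]]] :=
  @runs_while _ (NLe (NLit 1) (nreg GO)) walk_step s3 (K * m.+1)
   (walk_measure m v) (walk_state m v) _ _ ws3.
  by apply: step_r => //; rewrite -lt0n; exact: go4.
exists k, s4; split => //.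
  (* The measure is initially at most [m.+1], hence at most [m.+2] tests. *)
  apply: (leq_trans le_k); rewrite leq_mul2r /walk_measure go3; apply/orP; right.
  by rewrite !ltnS leq_subr.
split => //.
by apply: opt4; move: go4; rewrite /= -leqNgt leqn0 => /eqP.
Qed.

End WalkProgram.

(** * Correctness of the case distinction *)

Section Optimality.
Variable R : realType.
Implicit Types (O : set (R * R)) (z : R * R).

Definition min_enclosing O z (d : R) : Prop :=
  [/\ exists2 x, O x & sqd x z = d, forall x, O x -> sqd x z <= d &
      forall z', exists2 x, O x & d <= sqd x z'].

Variables (p : nat) (a : nat -> R * R) (r : nat -> R) (i0 m : nat) (v : nat -> R * R).
Hypotheses (p0 : (0 < p)%N) (r0 : forall i, (i < p)%N -> 0 < r i).
Hypothesis O0 : lens p a r !=set0.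
Hypotheses (i0p : (i0 < p)%N) (r_min : forall i, (i < p)%N -> r i0 <= r i).
Hypothesis v_lens : forall k, (k < m)%N -> lens p a r (v k).
Hypothesis vertex_v : forall x, vertex p a r x -> exists2 k, (k < m)%N & x = v k.

Let r2_min i : (i < p)%N -> r i0 ^+ 2 <= r i ^+ 2.
Proof. by move=> ip; rewrite ler_sqr ?nnegrE ?(ltW (r0 _)) ?r_min. Qed.

Lemma smallest_disk_optimal :
  (forall z', exists2 x, lens p a r x & r i0 ^+ 2 <= sqd x z') ->
  min_enclosing (lens p a r) (a i0) (r i0 ^+ 2).
Proof.
move=> h; split => //; last by move=> x Ox; exact: Ox.
have [x Ox hx] := h (a i0); exists x => //; apply/eqP; rewrite eq_le hx andbT.
exact: Ox.
Qed.

Lemma no_vertex_optimal : m = 0%N -> min_enclosing (lens p a r) (a i0) (r i0 ^+ 2).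
Proof.
move=> m0; apply: smallest_disk_optimal => z'.
have [x [Ox _ [/vertex_v[k]|[i [ip h _]]]]] := farthest_point z' p0 r0 O0.
  by rewrite m0.
by exists x => //; apply: le_trans h; exact: r2_min.
Qed.

Lemma large_walk_optimal A z : walk_optimal m v A z -> r i0 ^+ 2 <= sqd A z ->
  min_enclosing (lens p a r) (a i0) (r i0 ^+ 2).
Proof.
move=> opt h; apply: smallest_disk_optimal => z'; have [k km hk] := opt z'.
by exists (v k); [exact: v_lens|exact: le_trans hk].
Qed.

Definition far_points_enclosed z (d : R) n : Prop := forall i, (i < n)%N ->
  lens p a r (far_point z (a i) (r i)) -> sqd (far_point z (a i) (r i)) z <= d.

(** If a ball of radius below the least one enclosed the lens, [vertices_enclose_lens] would make
    the ball of the walk enclose it too, opposite points included. *)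
Lemma far_points_optimal A z : sqd A z < r i0 ^+ 2 ->
  (forall k, (k < m)%N -> sqd (v k) z <= sqd A z) ->
  ~ far_points_enclosed z (sqd A z) p ->
  min_enclosing (lens p a r) (a i0) (r i0 ^+ 2).
Proof.
move=> lt_r enc nfar; apply: smallest_disk_optimal => z'.
have [x [Ox xmax _]] := farthest_point z' p0 r0 O0.
exists x => //; rewrite leNgt; apply/negP => lt_x; apply: nfar => i ip fO.
apply: (@vertices_enclose_lens _ p a r z (sqd A z) z' (sqd x z') (r i0 ^+ 2)) => //.
by move=> y /vertex_v[k km ->]; exact: enc.
Qed.

(** The farthest point from [z] is a vertex or an opposite point, and both kinds are enclosed;
    optimality for the listed points passes to the lens. *)
Lemma walk_enclosing A z : walk_optimal m v A z ->
  (forall k, (k < m)%N -> sqd (v k) z <= sqd A z) ->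
  (exists2 k, (k < m)%N & A = v k) ->
  far_points_enclosed z (sqd A z) p ->
  min_enclosing (lens p a r) z (sqd A z).
Proof.
move=> opt enc [k km Ak] far; split.
- by exists A => //; rewrite Ak; exact: v_lens.
- have [x [Ox xmax hx]] := farthest_point z p0 r0 O0.
  move=> y /xmax/le_trans; apply; case: hx => [/vertex_v[j jm ->]|[i [ip _ xE]]].
    exact: enc.
  by move: Ox; rewrite xE; exact: far.
- by move=> z'; have [j jm h] := opt z'; exists (v j) => //; exact: v_lens.
Qed.

End Optimality.

(** * The complete program *)

Section Main.
Variable R : realType.
Implicit Types (s : state R) (a : nat -> R * R) (r : nat -> R).

Definition find_min_init : prog :=
  MX :=r RGet AX (NLit 0) ;; MY :=r RGet AY (NLit 0) ;; MR :=r RGet RAD (NLit 0).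

Definition find_min_step : prog :=
  If (RLe (rreg MR) (RGet RAD (nreg I_))) Skip
    (MX :=r RGet AX (nreg I_) ;; MY :=r RGet AY (nreg I_) ;; MR :=r RGet RAD (nreg I_)).

Definition find_min : prog := find_min_init ;; for_loop I_ PSIZE find_min_step.

Lemma find_min_runs : exists K, forall p a r s, has_input p a r s -> (0 < p)%N ->
  runs find_min s (K * p.+1) (fun s' => has_input p a r s' /\ exists i,
    [/\ (i < p)%N, pair_at s' MX MY = a i, rmem s' MR 0 = r i &
        forall j, (j < p)%N -> r i <= r j]).
Proof.
exists (pcost find_min_init + (pcost find_min_step + 15))%N => p a r s hin p0.
pose I n s' := has_input p a r s' /\ exists i,
    [/\ (i < p)%N, pair_at s' MX MY = a i, rmem s' MR 0 = r i &
        forall j, (j < n)%N -> r i <= r j].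
apply: (@runs_weaken _ _ _ (pcost find_min_init + p.+1 * (pcost find_min_step + 15)) _ (I p)).
- apply: (@runs_seq _ _ _ _ _ _ (I 0)).
    apply: wp_runs; do 3 (split; first by []); cbv beta; case: hin => h1 h2 h3 h4.
    split; first by split.
    exists 0; split => //; rewrite /pair_at /= /upd /= ?h4//.
    by rewrite h2 h3 -surjective_pairing.
  move=> s0 I0; have [[pE _ _ _] _] := I0; apply: runs_for => //.
  move=> n s1 n_lt nE [[h1 h2 h3 h4] [i [ip mE rE le_r]]].
  apply: wp_runs; apply: wp_if; first by [].
    rewrite tval_le /= nE rE h4 => h; split; first by split.
    exists i; split => // j; rewrite ltnS leq_eqVlt => /orP[/eqP->//|]; exact: le_r.
  rewrite tval_le /= nE rE h4 -ltNge => h.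
  do 3 (split; first by []); cbv beta; split; first by split.
  exists n; split; first by [].
  - by rewrite /pair_at /= /upd /= nE h2 h3 -surjective_pairing.
  - by rewrite /= /upd /= nE h4.
  move=> j; rewrite ltnS leq_eqVlt => /orP[/eqP->//|j_lt].
  by apply: le_trans (ltW h) _; exact: le_r.
- by move: (pcost find_min_init) (pcost find_min_step) => x y; nia.
- by move=> s'; exact.
Qed.

Definition check_point : prog :=
  WW :=r sqd_exp (RGet AX (nreg I_)) (RGet AY (nreg I_)) (rreg CC1) (rreg CC2) ;;
  If (RLe (rreg WW) (RLit 0))
    (QX :=r RSub (RGet AX (nreg I_)) (RGet RAD (nreg I_)) ;; QY :=r RGet AY (nreg I_))
    (TT :=r RDiv (RGet RAD (nreg I_)) (RSqrt (rreg WW)) ;;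
     QX :=r RAdd (RGet AX (nreg I_)) (RMul (rreg TT) (RSub (RGet AX (nreg I_)) (rreg CC1))) ;;
     QY :=r RAdd (RGet AY (nreg I_)) (RMul (rreg TT) (RSub (RGet AY (nreg I_)) (rreg CC2)))).

Definition check_test : prog :=
  If (NLe (NLit 1) (nreg FLAG))
    (If (RLe (sqd_exp (rreg QX) (rreg QY) (rreg CC1) (rreg CC2)) (rreg RHO))
       Skip (OK :=n NLit 0))
    Skip.

Definition check_step : prog := check_point ;; inside ;; check_test.

Definition check : prog := OK :=n NLit 1 ;; for_loop I_ PSIZE check_step.

Lemma check_step_runs : exists K, forall p a r s z i (d : R), has_input p a r s ->
  pair_at s CC1 CC2 = z -> rmem s RHO 0 = d -> nmem s I_ 0 = i ->
  runs check_step s (K * p.+1) (fun s' =>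
    [/\ has_input p a r s', pair_at s' CC1 CC2 = z, rmem s' RHO 0 = d &
      nmem s' OK 0 = if `[< lens p a r (far_point z (a i) (r i)) >] &&
          ~~ (sqd (far_point z (a i) (r i)) z <= d) then 0%N else nmem s OK 0]).
Proof.
have [K inside_r] := inside_runs R.
exists (pcost check_point + K + pcost check_test)%N => p a r s z i d hin cE dE iE.
set f := far_point z (a i) (r i).
apply: (@runs_weaken _ _ _ (pcost check_point + (K * p.+1 + pcost check_test))); last 2 first.
- by move: (pcost check_point) (pcost check_test) => x y; nia.
- by move=> s'; exact.
apply: (@runs_seq _ _ _ _ _ _ (fun s1 => [/\ has_input p a r s1,
   pair_at s1 CC1 CC2 = z, rmem s1 RHO 0 = d, pair_at s1 QX QY = f &
   nmem s1 OK 0 = nmem s OK 0])).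
  case: hin => h1 h2 h3 h4; apply: wp_runs; split; first by []; cbv beta.
  have cE1 : rmem s CC1 0 = z.1 by rewrite -cE.
  have cE2 : rmem s CC2 0 = z.2 by rewrite -cE.
  match goal with |- wp _ ?s _ => set s1 := s end.
  have wE : rmem s1 WW 0 = sqd (a i) z.
    by rewrite /s1 /= /upd /= iE h2 h3 cE1 cE2.
  have [en ax1 ay1 rad1] : [/\ nmem s1 = nmem s, rmem s1 AX = rmem s AX,
      rmem s1 AY = rmem s AY & rmem s1 RAD = rmem s RAD] by [].
  have [cc1 cc2 rho1] : [/\ rmem s1 CC1 = rmem s CC1, rmem s1 CC2 = rmem s CC2 &
      rmem s1 RHO = rmem s RHO] by [].
  have fin s' : nmem s' = nmem s1 ->
      [/\ rmem s' AX = rmem s1 AX, rmem s' AY = rmem s1 AY & rmem s' RAD = rmem s1 RAD] ->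
      [/\ rmem s' CC1 = rmem s1 CC1, rmem s' CC2 = rmem s1 CC2 &
          rmem s' RHO = rmem s1 RHO] ->
      pair_at s' QX QY = f ->
      [/\ has_input p a r s', pair_at s' CC1 CC2 = z, rmem s' RHO 0 = d,
          pair_at s' QX QY = f & nmem s' OK 0 = nmem s OK 0].
    move=> en' [x' y' r'] [c1' c2' rho'] qE; split => //; last by rewrite en' en.
    - by split; rewrite ?en' ?en ?x' ?ax1 ?y' ?ay1 ?r' ?rad1.
    - by rewrite /pair_at c1' cc1 c2' cc2.
    - by rewrite rho' rho1.
  clearbody s1.
  apply: wp_if; first by [].
    rewrite tval_le /= wE => w0; have {}w0 : sqd (a i) z <= 0 := w0.
    do 2 (split; first by []); cbv beta.
    apply: fin => //; rewrite /pair_at /= /upd /= en iE ax1 ay1 rad1 h2 h3 h4.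
    by rewrite /f /far_point w0.
  rewrite tval_le /= wE => w0; have {}w0 : ~~ (sqd (a i) z <= 0) := w0.
  split; first by split => //=; rewrite ?wE ?sqd_ge0// sqrtr_eq0.
  do 2 (split; first by []); cbv beta.
  apply: fin => //; rewrite /pair_at /= /upd /= wE en iE ax1 ay1 rad1 cc1 cc2 h2 h3 h4.
  by rewrite /f /far_point (negPf w0) cE1 cE2.
move=> s1 [in1 c1 d1 q1 ok1].
have := inside_r p a r s1 in1; rewrite -/(pair_at s1 QX QY) q1.
move=> /runs_frame/runs_seq; apply => s2 [f2 fr2].
have in2 : has_input p a r s2 by apply: has_input_frame fr2 in1.
have [c2 d2 q2 ok2] : [/\ pair_at s2 CC1 CC2 = z, rmem s2 RHO 0 = d,
    pair_at s2 QX QY = f & nmem s2 OK 0 = nmem s OK 0].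
  by rewrite /pair_at !fr2.2// fr2.1.
have testE : tval s2 (RLe (sqd_exp (rreg QX) (rreg QY) (rreg CC1) (rreg CC2)) (rreg RHO)) =
    (sqd f z <= d) by rewrite -q2 -c2 -d2.
apply/wp_runs; apply: wp_if => //=; rewrite f2.
  rewrite lt0b => fO; apply: wp_if; first by [].
    by rewrite testE => h; split => //; rewrite fO h.
  rewrite testE => h; rewrite /wp; split => //.
  by rewrite fO h.
by rewrite lt0b => fO; split => //; rewrite (negPf fO).
Qed.

Lemma check_runs : exists K, forall p a r s z (d : R), has_input p a r s ->
  pair_at s CC1 CC2 = z -> rmem s RHO 0 = d ->
  runs check s (K * p.+1 ^ 2) (fun s' =>
    nmem s' OK 0 = `[< far_points_enclosed p a r z d p >]).
Proof.
have [K step_r] := check_step_runs.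
exists (K + 18)%N => p a r s z d hin cE dE.
pose I n s' := [/\ has_input p a r s', pair_at s' CC1 CC2 = z, rmem s' RHO 0 = d &
  nmem s' OK 0 = `[< far_points_enclosed p a r z d n >]].
apply: (@runs_weaken _ _ _ (3 + p.+1 * (K * p.+1 + 15)) _ (I p)).
- apply: (@runs_seq _ _ _ _ 3 _ (fun s' => s' = nset s OK 1)).
    exact: (@wp_runs _ (OK :=n NLit 1)).
  move=> _ ->; have [pE _ _ _] := hin; apply: runs_for => //.
    by split => //=; rewrite /upd /=; case: asboolP => // h; case: h => i.
  move=> n s1 n_lt iE [in1 c1 d1 ok1].
  have := step_r p a r s1 z n d in1 c1 d1 iE.
  move=> /runs_weaken; apply => // s2 [in2 c2 d2 ok2]; split => //.
  rewrite /= /upd /= ok2 ok1; set f := far_point _ _ _.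
  have -> : `[< far_points_enclosed p a r z d n.+1 >] =
      `[< far_points_enclosed p a r z d n >] && (`[< lens p a r f >] ==> (sqd f z <= d)).
    apply/asboolP/andP => [h|[/asboolP h /implyP h'] i].
      split; first by apply/asboolP => i i_lt; apply: h; exact: ltnW.
      by apply/implyP => /asboolP; exact: h.
    rewrite ltnS leq_eqVlt => /orP[/eqP-> fO|]; last exact: h.
    by apply: h'; apply/asboolP.
  by case: asboolP; case: asboolP => //=; case: (_ <= _).
- by nia.
- by move=> s' [].
Qed.

End Main.

(** * Assembly of the phases and total cost *)

Section Solve.
Variable R : realType.
Implicit Types (s : state R) (a : nat -> R * R) (r : nat -> R).

Definition emit x y d : prog :=
  RSet OUT (NLit 0) x ;; RSet OUT (NLit 1) y ;; RSet OUT (NLit 2) d.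

Definition emit_smallest : prog := emit (rreg MX) (rreg MY) (sqr_exp (rreg MR)).

Definition emit_walk : prog := emit (rreg CC1) (rreg CC2) (rreg RHO).

Definition set_radius : prog :=
  RHO :=r sqd_exp (rreg AA1) (rreg AA2) (rreg CC1) (rreg CC2).

Definition try_vertices : prog :=
  walk ;; set_radius ;;
  If (RLe (sqr_exp (rreg MR)) (rreg RHO)) Skip
    (check ;; If (NLe (NLit 1) (nreg OK)) emit_walk Skip).

(** The smallest disk is written first as a default answer, and overwritten only when the ball of
    the walk passes every test. *)
Definition solve : prog :=
  collect_all ;; find_min ;; emit_smallest ;;
  If (NLe (NLit 1) (nreg COUNT)) try_vertices Skip.

Definition output_optimal O s : Prop :=
  min_enclosing O (rmem s OUT 0, rmem s OUT 1) (rmem s OUT 2).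

Lemma try_vertices_runs : exists K, forall p a r s i m v,
  (0 < p)%N -> (forall j, (j < p)%N -> 0 < r j) -> lens p a r !=set0 ->
  has_input p a r s -> has_points m v s -> (0 < m <= 2 * p)%N ->
  (forall k, (k < m)%N -> lens p a r (v k)) ->
  (forall x, vertex p a r x -> exists2 k, (k < m)%N & x = v k) ->
  (i < p)%N -> (forall j, (j < p)%N -> r i <= r j) -> rmem s MR 0 = r i ->
  (rmem s OUT 0, rmem s OUT 1) = a i -> rmem s OUT 2 = r i ^+ 2 ->
  runs try_vertices s (K * p.+1 ^ 2) (output_optimal (lens p a r)).
Proof.
have [K1 walk_r] := walk_runs R; have [K2 check_r] := check_runs R.
exists (4 * K1 + pcost set_radius + 30 + K2 + pcost emit_walk)%N.
move=> p a r s i m v p0 r0 O0 hin hp /andP[m0 m_le] v_lens vertex_v ip r_min rE oE dE.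
apply: (@runs_weaken _ _ _ (K1 * m.+1 ^ 2 + (pcost set_radius +
  (tcost (RLe (sqr_exp (rreg MR)) (rreg RHO)) + (K2 * p.+1 ^ 2 +
   (4 + (pcost emit_walk + 1))))))); last 2 first.
- have -> : tcost (RLe (sqr_exp (rreg MR)) (rreg RHO)) = 8 by [].
  (* At most two candidates per circle give [m.+1 <= 2 * p.+1]; hence the factor 4 on [K1]. *)
  have : (m.+1 ^ 2 <= 4 * p.+1 ^ 2)%N.
    by rewrite -[4%N]/(2 ^ 2)%N -expnMn leq_exp2r// (leq_trans (_ : _ <= (2 * p).+1)%N) //; lia.
  by move: (pcost set_radius) (pcost emit_walk) => x y; nia.
- by move=> s'; exact.
have /runs_frame/runs_seq := walk_r m v s hp m0; apply=> s1 [[hp1 vA enc opt] fr1].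
have in1 : has_input p a r s1 by apply: has_input_frame fr1 hin.
have {}rE : rmem s1 MR 0 = r i by rewrite fr1.2.
have {}oE : (rmem s1 OUT 0, rmem s1 OUT 1) = a i by rewrite fr1.2.
have {}dE : rmem s1 OUT 2 = r i ^+ 2 by rewrite fr1.2.
set A := pair_at s1 AA1 AA2 in vA enc opt; set z := pair_at s1 CC1 CC2 in enc opt.
pose s2 := State (nmem s1) (upd (rmem s1) RHO 0 (sqd A z)).
apply: (@runs_seq _ _ _ _ _ _ (fun s' => s' = s2)).
  by apply: (@wp_runs _ set_radius); split.
have outE : rmem s2 OUT = rmem s1 OUT by [].
move=> _ ->; apply: runs_if; first by [].
  rewrite tval_le rval_sqr => h; apply: (@runs_weaken _ _ _ 1 _ (fun s' => s' = s2)).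
  - exact: (@wp_runs _ Skip).
  - by move: (pcost _) => x; nia.
  - move=> _ ->; rewrite /output_optimal outE oE dE.
    by apply: (large_walk_optimal ip v_lens opt); rewrite -rE.
rewrite tval_le rval_sqr -ltNge => h.
have lt_r : sqd A z < r i ^+ 2 by rewrite -rE; exact: h.
have in2 : has_input p a r s2 by case: in1; split.
have := check_r p a r s2 z (sqd A z) in2 erefl erefl.
move=> /runs_frame/runs_seq; apply => s3 [ok3 fr3].
apply: (@runs_weaken _ _ _ (pcost (If (NLe (NLit 1) (nreg OK)) emit_walk Skip)) _
  (output_optimal (lens p a r))) => //.
apply/wp_runs; apply: wp_if => //=; rewrite ok3.
  rewrite lt0b => /asboolP far.
  do 2 (split; first by []); split; first by [].
  rewrite /output_optimal /= /upd /= !fr3.2//.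
  exact: (walk_enclosing p0 r0 O0 v_lens vertex_v opt enc vA far).
rewrite lt0b => /asboolPn far.
rewrite /wp /output_optimal !fr3.2// outE oE dE.
exact: (far_points_optimal p0 r0 O0 ip r_min vertex_v lt_r enc far).
Qed.

Lemma solve_runs : exists K, forall p a r s,
  (0 < p)%N -> (forall j, (j < p)%N -> 0 < r j) -> lens p a r !=set0 ->
  has_input p a r s -> runs solve s (K * p.+1 ^ 2) (output_optimal (lens p a r)).
Proof.
have [K1 collect_r] := collect_all_runs R; have [K2 min_r] := find_min_runs R.
have [K3 try_r] := try_vertices_runs.
exists (K1 + K2 + pcost emit_smallest + 5 + K3)%N => p a r s p0 r0 O0 hin.
apply: (@runs_weaken _ _ _ (K1 * p.+1 ^ 2 + (K2 * p.+1 + (pcost emit_smallest +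
  (tcost (NLe (NLit 1) (nreg COUNT)) + (K3 * p.+1 ^ 2 + 1)))))); last 2 first.
- have -> : tcost (NLe (NLit 1) (nreg COUNT)) = 4 by [].
  by move: (pcost emit_smallest) => x; nia.
- by move=> s'; exact.
apply: runs_seq (collect_r p a r s hin) _ => s1 [in1 m_le foundE].
have /runs_frame/runs_seq := min_r p a r s1 in1 p0.
apply=> s2 [[in2 [i [ip aE rE r_min]]] fr2].
pose m := nmem s1 COUNT 0; pose v k := (rmem s1 VX k, rmem s1 VY k).
have hp2 : has_points m v s2 by split; rewrite ?fr2.1// ?fr2.2.
have v_lens k : (k < m)%N -> lens p a r (v k).
  by move=> km; have /foundE[] : found s1 (v k) by exists k.
have vertex_v x : vertex p a r x -> exists2 k, (k < m)%N & x = v k.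
  move=> xV; apply/foundE; split; first by case: xV.
  exact: vertex_corner.
apply: (@runs_seq _ _ _ _ _ _ (fun s3 => [/\ has_input p a r s3, has_points m v s3,
   rmem s3 MR 0 = r i, (rmem s3 OUT 0, rmem s3 OUT 1) = a i & rmem s3 OUT 2 = r i ^+ 2])).
  apply: (@wp_runs _ emit_smallest); do 3 (split; first by []); cbv beta.
  split; [by case: in2; split|by case: hp2; split|by []|by []|].
  by rewrite /= /upd /= -rE.
move=> s3 [in3 hp3 rE3 oE3 dE3]; have [hm _ _] := hp3.
apply: runs_if; first by [].
  rewrite /= hm => m0.
  apply: (@runs_weaken _ _ _ (K3 * p.+1 ^ 2) _ (output_optimal (lens p a r))) => //.
    by apply: (@try_r p a r s3 i m v) => //; rewrite m0.
  exact: leq_addr.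
rewrite /= hm -leqNgt leqn0 => /eqP m0.
apply: (@runs_weaken _ _ _ 1 _ (fun s' => s' = s3)).
- exact: (@wp_runs _ Skip).
- exact: leq_addl.
- move=> _ ->; rewrite /output_optimal oE3 dE3.
  exact: (no_vertex_optimal p0 r0 O0 ip r_min vertex_v m0).
Qed.

End Solve.

(** * Transfer from pairs to row vectors *)

Lemma sqdistE (R : realType) (x y : 'rV[R]_2) :
  sqdist x y = sqd (x ord0 0, x ord0 1) (y ord0 0, y ord0 1).
Proof. by rewrite /sqdist big_ord_recl big_ord1 /sqd /= (_ : lift _ _ = 1)//; apply: val_inj. Qed.

Lemma chebyshev_solutionE (R : realType) (O : set 'rV[R]_2) (O' : set (R * R))
    (z : 'rV[R]_2) (m : R) :
  (forall x, O x <-> O' (x ord0 0, x ord0 1)) ->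
  min_enclosing O' (z ord0 0, z ord0 1) m -> chebyshev_solution O z m.
Proof.
move=> OO' [[x Ox xm] le_m m_opt].
have lift_pt (y : R * R) : exists y' : 'rV[R]_2, (y' ord0 0, y' ord0 1) = y.
  by exists (\row_(k < 2) if k == 0 then y.1 else y.2); rewrite !mxE -surjective_pairing.
have zm : max_sqdist O z m.
  split=> [|_ [y Oy <-]]; last by rewrite sqdistE; apply/le_m/OO'.
  have [x' xE] := lift_pt x; exists x'; last by rewrite sqdistE xE.
  by apply/OO'; rewrite xE.
split => //; split; first by exists z.
(* Any maximum [m'] about [z'] dominates the point at squared distance at least [m] from [z']. *)
move=> m' [z' [_ ub]]; have [y Oy my] := m_opt (z' ord0 0, z' ord0 1).
have [y' yE] := lift_pt y; apply: (le_trans my); apply: ub.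
by exists y'; [apply/OO'; rewrite yE|rewrite sqdistE yE].
Qed.

Theorem theorem1 (R : realType) :
  exists (c : prog) (C : nat),
    forall (p : nat) (a : 'I_p -> 'rV[R]_2) (r : 'I_p -> R),
      (0 < p)%N ->
      (forall i, 0 < r i) ->
      interior (ball_inter a r) !=set0 ->
      exists (k : nat) (s : state R),
        [/\ exec c (input a r) k s,
            (k <= C * p ^ 2)%N &
            chebyshev_solution (ball_inter a r)
              (output_center s) (output_value s)].
Proof.
(* The factor 4 comes from [p.+1 <= 2 * p] for positive [p]. *)
have [K solve_r] := solve_runs R; exists solve, (4 * K)%N => p a r p0 r0 [x0 /interior_subset Ox0].
pose a' k := (tabulate (fun j => a j ord0 0) k, tabulate (fun j => a j ord0 1) k).
have tabE f (i : 'I_p) : tabulate f i = f i by rewrite /tabulate (valK i).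
have lensE x : ball_inter a r x <-> lens p a' (tabulate r) (x ord0 0, x ord0 1).
  split=> [Ox j jp|Ox i].
    by have := Ox (Ordinal jp); rewrite sqdistE -[j]/(nat_of_ord (Ordinal jp)) /a' !tabE.
  by have := Ox i (ltn_ord i); rewrite sqdistE /a' !tabE.
have [|||k [s [e le_k opt]]] := solve_r p a' (tabulate r) (input a r) p0.
- by move=> j jp; rewrite -[j]/(nat_of_ord (Ordinal jp)) tabE.
- by exists (x0 ord0 0, x0 ord0 1); apply/lensE.
- by split.
exists k, s; split => //.
  by apply: (leq_trans le_k); nia.
by apply: (chebyshev_solutionE lensE); rewrite !mxE.
Qed.
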